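(* For every integer $n\ge 2$, $$C(n) < 6n-0.695\,n^{2/3}.$$
   Context: A packing of unit balls in $\mathbb{E}^3$ is a family of closed unit balls with pairwise disjoint interiors. The contact number $C(\mathcal{P})$ of a finite packing $\mathcal{P}$ is the number of unordered pairs of its balls that touch (i.e. whose centers are at distance exactly $2$). $C(n)$ denotes the maximum of $C(\mathcal{P})$ over all packings $\mathcal{P}$ of $n$ unit balls in $\mathbb{E}^3$. *)

(* Defs.v *)
From Stdlib Require Import Reals List Arith.
Import ListNotations.
Open Scope R_scope.

Definition point3 : Type := (R * R * R)%type.

Definition dist3 (p q : point3) : R :=
  let '(x1, y1, z1) := p in
  let '(x2, y2, z2) := q in
  sqrt ((x1 - x2)^2 + (y1 - y2)^2 + (z1 - z2)^2).

(* A packing of n closed unit balls, given by their centers c 0, ..., c (n-1):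
   two closed unit balls have disjoint interiors iff their centers are at
   distance >= 2. *)
Definition is_unit_ball_packing (n : nat) (c : nat -> point3) : Prop :=
  forall i j : nat, (i < n)%nat -> (j < n)%nat -> i <> j -> 2 <= dist3 (c i) (c j).

Definition touchb (p q : point3) : bool :=
  if Req_EM_T (dist3 p q) 2 then true else false.

Definition contact_number (n : nat) (c : nat -> point3) : nat :=
  length (filter (fun ij : nat * nat =>
                    andb (Nat.ltb (fst ij) (snd ij)) (touchb (c (fst ij)) (c (snd ij))))
                 (list_prod (seq 0 n) (seq 0 n))).

(* Main.v *)
(* Write [m i] for 12 minus the number of balls touching ball [i], so that there are
   6 n - (sum of the m i) / 2 contacts; it suffices that the m i sum to more than 1.39 n^(2/3).
   Let [A r] be the union of the balls of radius [r] about the centers.  Since [A 2] contains n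
   disjoint unit balls, the Brunn-Minkowski inequality shows that A (2 + h) exceeds A 2 by at least
   3 h n^(2/3) V, where V is the volume of the unit ball.  A point of A (2 + h) outside A 2, seen
   from its nearest center c i, makes an angle of at least 60 degrees with every contact direction
   of ball i (call it exposed at i).  The orbit of a point under sign changes and cyclic
   permutations of the coordinates splits into 4 classes of 6 points that are pairwise at least 60
   degrees apart, so, the kissing number being 12, at most [m i] points of each class are exposed:
   as these symmetries preserve volume, the exposed part of the shell between the radii 2 and 2 + h
   has at most m i / 6 of its volume.  Summing over i with h = 1/10 gives
   sum of the m i >= (18 / 12.61) n^(2/3).

   The kissing number is bounded by the three-point semidefinite method of Bachoc and Vallentin,
   with an explicit sum-of-squares certificate in rational arithmetic.  The certified identities
   only hold up to rounding, but the inner products lie in [-1, 1], so the residual polynomial is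
   bounded below by its constant term minus the absolute values of its other coefficients. *)
From Stdlib Require Import ZArith.
From Stdlib Require Ring_polynom.
Require Import Defs.
From Stdlib Require Import Reals List Arith.
From HB Require structures.
From mathcomp Require all_boot all_order all_algebra all_classical all_reals all_analysis.
From mathcomp Require measurable_realfun Rstruct Rstruct_topology ssrZ zify ring lra.
Open Scope R_scope.

(** * Integer data of the kissing number certificate *)

Module Certificate.
Import ListNotations.
Local Open Scope Z_scope.

(* Rounded Cholesky factors, at scale 2^20, of a numerical solution of the semidefinite program
   behind the three-point bound: each row lists the coefficients, in the bases defined below, of a
   polynomial whose square enters the certificate. *)
Definition zonal_rows : list (list (list Z)) :=
 [[[277314; 805412; 742392; -1035854; -2585523; -1487556]; [0; 464844; -1039778; -984262; 1705420;
  1376174]; [0; 0; 507311; -214551; -849339; 335205]; [0; 0; 0; 1210; 66; -3627]; [0; 0; 0; 0; 21;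
  -485]; [0; 0; 0; 0; 0; 520]];
  [[546724; 1511341; 1161549; -2584537; -1692040; 1250785]; [0; 960150; 652698; -959681; -1967906;
  -1308426]; [0; 0; 2084511; 49776; -6276915; -4020007]; [0; 0; 0; 684; -499; -262]; [0; 0; 0; 0;
  1187; 1288]; [0; 0; 0; 0; 0; 541]];
  [[358371; 897794; 975971; -558497; -731918]; [0; 736208; 304411; -842512; -949980]; [0; 0; 609072;
  544036; 544470]; [0; 0; 0; 1374; 2173]; [0; 0; 0; 0; 364]];
  [[409742; 1075280; 199488; -1393551]; [0; 370541; -208026; -108532]; [0; 0; 272; -133]; [0; 0; 0;
  258]];
  [[213597; 636763; -313514]; [0; 395; -234]; [0; 0; 93]]].
Definition sos_triv : list (list Z) :=
  [[5672; 106293; -13482; 96286; -267708; -670937; -36511; -75266; -530260; -181340; -225004;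
  236512; 282486; 808570; 151745; 743828; 137610; 208078; 575795; 138737; 338028; 825184; 175021];
  [0; 7013; 68886; 91332; -43561; 177022; 5032; -174054; -407410; -265915; -328811; -196267;
  -640431; 263554; -27864; -120458; -78702; -457321; 245886; 151671; 576586; 1143382; 525867]; [0;
  0; 4315; -20412; -71571; 14430; -13523; -174349; -129506; 227892; 253248; -252148; 299260; 789317;
  81946; -641685; -115852; 277753; 139730; -33136; 589525; -986235; -251679]; [0; 0; 0; 7296; 19384;
  301; 4013; 46176; 30086; -69206; -77369; 68266; -97129; -219079; -24059; 177857; 31734; -87674;
  -35426; 12013; -156517; 298593; 80903]; [0; 0; 0; 0; 613; -144; -46; 435; 840; -206; -604; -178;
  -1391; -2971; 41; 2803; -224; -1300; -971; -82; -2542; 2877; -77]; [0; 0; 0; 0; 0; 622; 127; 155;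
  1018; -66; -44; 759; -2334; -2028; -631; 1042; 493; -2161; -746; -629; -1867; 274; -258]; [0; 0;
  0; 0; 0; 0; 228; 573; 753; -997; -455; 1287; -41; -2409; -1000; 1219; 626; -308; -89; -409; -2075;
  1525; 979]; [0; 0; 0; 0; 0; 0; 0; 946; 1257; -1867; -1651; 2434; -1730; -4058; -107; 3648; 1355;
  -2099; -228; 601; -3339; 6536; 2440]; [0; 0; 0; 0; 0; 0; 0; 0; 385; -162; -495; 532; -517; -901;
  -11; 994; 421; -292; 335; 412; -1173; 1360; -97]; [0; 0; 0; 0; 0; 0; 0; 0; 0; 133; 260; 116; 541;
  -361; 24; -370; 112; 628; -477; -147; -358; -1222; -237]; [0; 0; 0; 0; 0; 0; 0; 0; 0; 0; 220; -11;
  174; 117; 16; -340; 42; 21; -295; 3; 64; -1001; 275]; [0; 0; 0; 0; 0; 0; 0; 0; 0; 0; 0; 340; 548;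
  -745; 30; -204; 306; 860; -278; 209; -717; -369; -58]; [0; 0; 0; 0; 0; 0; 0; 0; 0; 0; 0; 0; 438;
  -80; 50; -409; 1; 396; 163; 339; -1; -692; -264]; [0; 0; 0; 0; 0; 0; 0; 0; 0; 0; 0; 0; 0; 91; 28;
  -102; 6; -43; 87; 107; 112; -201; -91]; [0; 0; 0; 0; 0; 0; 0; 0; 0; 0; 0; 0; 0; 0; 42; -9; -3;
  -11; 82; 109; 34; -128; -126]; [0; 0; 0; 0; 0; 0; 0; 0; 0; 0; 0; 0; 0; 0; 0; 80; -14; 106; 65;
  -50; -129; 8; -69]; [0; 0; 0; 0; 0; 0; 0; 0; 0; 0; 0; 0; 0; 0; 0; 0; 32; -113; -244; 1; 90; 12;
  268]; [0; 0; 0; 0; 0; 0; 0; 0; 0; 0; 0; 0; 0; 0; 0; 0; 0; 125; -88; -40; -159; 12; 122]; [0; 0; 0;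
  0; 0; 0; 0; 0; 0; 0; 0; 0; 0; 0; 0; 0; 0; 0; 130; 94; 38; -130; -157]; [0; 0; 0; 0; 0; 0; 0; 0; 0;
  0; 0; 0; 0; 0; 0; 0; 0; 0; 0; 77; -23; -103; 53]; [0; 0; 0; 0; 0; 0; 0; 0; 0; 0; 0; 0; 0; 0; 0; 0;
  0; 0; 0; 0; 38; 11; -5]; [0; 0; 0; 0; 0; 0; 0; 0; 0; 0; 0; 0; 0; 0; 0; 0; 0; 0; 0; 0; 0; 108; 39];
  [0; 0; 0; 0; 0; 0; 0; 0; 0; 0; 0; 0; 0; 0; 0; 0; 0; 0; 0; 0; 0; 0; 18]].
Definition sos_sign : list (list Z) :=
  [[472; 893; 841; 2379; 308; 2365; 1547]; [0; 290; 747; 756; 462; 723; 540]; [0; 0; 403; 411; 400;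
  244; 389]; [0; 0; 0; 136; -21; 215; 54]; [0; 0; 0; 0; 48; -17; 240]; [0; 0; 0; 0; 0; 98; -10]; [0;
  0; 0; 0; 0; 0; 53]].
Definition sos_std : list (list Z) :=
  [[71963; -260422; -6450; -257685; 107911; -358910; 288011; 179812; -106111; 855464; 329490;
  417323; -234561; 72849; 377715; 936569; -408905; -663763; 178032; -173217; -25702; -913347;
  -611949; -778022; 644560; -128182; -543157]; [0; 286608; 183682; 181655; 544113; 435135; -257227;
  -155002; -359523; -738863; 411456; -257491; -445582; -664250; -78231; -1478128; 578517; -257437;
  -81076; -102663; -226123; 737868; -300048; 513406; -1077352; 247328; -1625704]; [0; 0; 283; -1442;
  -17819; -10802; -22949; -12307; -1710; 25351; 968; -45223; 8803; 11462; 63104; 85890; 24205;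
  40574; -23813; 3337; 4390; 46321; 23938; 26044; 11380; 28520; 14099]; [0; 0; 0; 7759; 77737;
  46385; 99800; 52399; 3847; -108340; -886; 193657; -37085; -52346; -274202; -373083; -102257;
  -180836; 101897; -11332; -19328; -201726; -109073; -110277; -53851; -129006; -81171]; [0; 0; 0; 0;
  6621; 4257; 9069; 3425; -63; -10845; -636; 19292; -3411; -4619; -24788; -33428; -9267; -15252;
  10292; -483; -1366; -17356; -7886; -9758; -3846; -9158; -3115]; [0; 0; 0; 0; 0; 777; -789; 190;
  533; 1619; 300; -1839; 781; -483; 1532; -545; 689; 1438; -1044; 265; -420; 1062; -2235; 694; -932;
  1285; 548]; [0; 0; 0; 0; 0; 0; 920; 347; -248; -1403; -601; 2038; 1357; 154; -2743; -3127; -938;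
  -1852; 1097; 1290; 465; -1284; -278; -306; -663; -3103; -1927]; [0; 0; 0; 0; 0; 0; 0; 956; 387;
  73; 171; 57; 363; -81; 169; -89; 357; -339; 32; -339; -250; 227; -603; 144; -1413; -3003; -3869];
  [0; 0; 0; 0; 0; 0; 0; 0; 184; 77; 391; 82; 403; 336; -178; -518; 60; -176; 89; 550; 275; -349;
  -582; -155; -960; 103; -1327]; [0; 0; 0; 0; 0; 0; 0; 0; 0; 318; 221; -23; 633; 680; -106; -966;
  12; -106; -28; 622; 656; -262; -1204; -153; -615; 92; -726]; [0; 0; 0; 0; 0; 0; 0; 0; 0; 0; 184;
  141; 79; 98; -290; -157; -188; -73; 149; 172; 129; -475; -102; -349; -116; 341; 4]; [0; 0; 0; 0;
  0; 0; 0; 0; 0; 0; 0; 456; 350; 373; -884; -984; -44; -328; 437; 610; 497; -492; -610; 282; -781;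
  -232; -905]; [0; 0; 0; 0; 0; 0; 0; 0; 0; 0; 0; 0; 788; 449; 106; -872; 143; -398; -9; 778; 482;
  587; -634; 560; -878; -377; -1607]; [0; 0; 0; 0; 0; 0; 0; 0; 0; 0; 0; 0; 0; 449; -208; -345; 101;
  324; -16; 91; 492; -66; -206; 70; -380; 53; 117]; [0; 0; 0; 0; 0; 0; 0; 0; 0; 0; 0; 0; 0; 0; 179;
  174; 54; 187; 7; -40; -22; 134; 137; 47; 88; 318; 368]; [0; 0; 0; 0; 0; 0; 0; 0; 0; 0; 0; 0; 0; 0;
  0; 219; 122; 58; -6; 104; 60; -87; 144; 33; 16; -61; 25]; [0; 0; 0; 0; 0; 0; 0; 0; 0; 0; 0; 0; 0;
  0; 0; 0; 243; -45; -9; 61; 46; 74; -70; 236; -143; -80; -337]; [0; 0; 0; 0; 0; 0; 0; 0; 0; 0; 0;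
  0; 0; 0; 0; 0; 0; 96; 2; -3; -9; -56; 28; -39; 52; 141; 286]; [0; 0; 0; 0; 0; 0; 0; 0; 0; 0; 0; 0;
  0; 0; 0; 0; 0; 0; 22; -67; -57; -136; -18; -40; 158; 36; 165]; [0; 0; 0; 0; 0; 0; 0; 0; 0; 0; 0;
  0; 0; 0; 0; 0; 0; 0; 0; 142; 99; -48; -74; -9; -325; -284; -528]; [0; 0; 0; 0; 0; 0; 0; 0; 0; 0;
  0; 0; 0; 0; 0; 0; 0; 0; 0; 0; 41; -24; 36; -48; -32; -88; 46]; [0; 0; 0; 0; 0; 0; 0; 0; 0; 0; 0;
  0; 0; 0; 0; 0; 0; 0; 0; 0; 0; 153; 29; 140; -8; 42; -35]; [0; 0; 0; 0; 0; 0; 0; 0; 0; 0; 0; 0; 0;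
  0; 0; 0; 0; 0; 0; 0; 0; 0; 104; 7; 142; 329; 429]; [0; 0; 0; 0; 0; 0; 0; 0; 0; 0; 0; 0; 0; 0; 0;
  0; 0; 0; 0; 0; 0; 0; 0; 61; -89; 107; -89]; [0; 0; 0; 0; 0; 0; 0; 0; 0; 0; 0; 0; 0; 0; 0; 0; 0; 0;
  0; 0; 0; 0; 0; 0; 93; 143; 210]; [0; 0; 0; 0; 0; 0; 0; 0; 0; 0; 0; 0; 0; 0; 0; 0; 0; 0; 0; 0; 0;
  0; 0; 0; 0; 206; 135]; [0; 0; 0; 0; 0; 0; 0; 0; 0; 0; 0; 0; 0; 0; 0; 0; 0; 0; 0; 0; 0; 0; 0; 0; 0;
  0; 28]].
Definition cap_sym : list (list Z) :=
  [[23195; 188094; 274711; 404120; 367910; -401691; 33779; 194105; -237876; -1215591; -201836;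
  -89491; -1617121; -175697; -118959; -1520413; -376531; 516478; -1688761; 664274; -201314; 765931;
  -134012; 402420; -995028; -200910; 85892; 457842; 872026; 83609; 1734688; 325635; 583095;
  1845086]; [0; 38653; -41097; -6027; 189467; 156916; 300722; -474650; 463366; 602398; 505044;
  639837; -257782; -794300; -133554; 575353; 211302; 806934; -1749070; 537043; -1292603; -991491;
  -413124; -253228; 520406; 179653; -406387; -1947950; 653575; -2018785; -2096736; -1841; -501960;
  -287648]; [0; 0; 34145; -143376; 246889; 279109; 141733; -15922; 70065; 384881; 245006; -73539;
  367494; 197253; 1639; 535116; -18720; -883578; -181613; -32579; -531879; -1124173; 63484; 42656;
  481864; -182028; -374751; -178570; -423194; -788535; -1362567; 169239; -252698; -1611011]; [0; 0;
  0; 10283; 2606; -9046; -6244; 12694; 14446; -9566; -6088; -4356; -10453; 5782; -3595; -43591;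
  -11032; 9747; -12117; -2212; 25711; 39260; 3728; -10238; -45575; -11084; -8160; -30201; 970;
  16463; 36903; -2911; 12929; 50745]; [0; 0; 0; 0; 4972; 2890; 2046; 253; 7698; 7748; 5074; 972;
  3223; 482; -1520; 1416; -1514; -7319; -12935; 860; -7825; -12108; -22; -3971; -859; -4424; -10328;
  -21607; -3840; -18365; -23435; 1319; -3741; -13442]; [0; 0; 0; 0; 0; 657; 423; -615; 680; 883;
  486; -356; 1252; -1301; 105; 850; 686; -1217; 760; -2938; -1675; 154; -685; -798; 995; 885; -498;
  -1765; -1891; -1114; -1062; -2028; -2194; 230]; [0; 0; 0; 0; 0; 0; 921; -1058; 410; 1192; 1375;
  1597; -1614; -2046; 15; 1196; 605; 3516; -4268; 1499; -3842; -1011; -1126; 243; 730; 457; -425;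
  -3624; 2386; -5094; -3207; -163; -1465; 2085]; [0; 0; 0; 0; 0; 0; 0; 1033; 137; -830; -289; -217;
  578; 1509; 1704; -389; -707; -1019; 106; 151; 10; -469; 518; 1413; -396; -956; -51; 542; -527;
  755; 1393; 505; -388; -2523]; [0; 0; 0; 0; 0; 0; 0; 0; 1121; -72; 43; -626; -324; 357; 1243; 132;
  638; -1191; 86; -613; -214; 264; 315; 430; 767; 803; -1868; -1658; -194; -222; -605; -213; 381;
  2561]; [0; 0; 0; 0; 0; 0; 0; 0; 0; 661; -7; 628; -1000; -204; 647; 795; -229; 1893; -2573; 2037;
  -227; -1903; -284; 891; 487; -265; 779; -1478; 1774; -985; -3041; 1288; 924; -1064]; [0; 0; 0; 0;
  0; 0; 0; 0; 0; 0; 501; -536; 343; -21; 210; -414; 317; -1514; 1255; -202; 219; 159; -55; 379;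
  -422; -261; -1475; 957; -789; -668; 249; 248; 336; 154]; [0; 0; 0; 0; 0; 0; 0; 0; 0; 0; 0; 687;
  -544; 257; 132; -194; -116; 1543; -1553; 474; -150; -277; 254; 188; -139; 221; 611; -475; 1040;
  -925; -453; -123; 168; -747]; [0; 0; 0; 0; 0; 0; 0; 0; 0; 0; 0; 0; 463; 231; 90; -333; -32; -99;
  199; -287; -10; 307; 274; -69; -318; 105; 312; 10; -636; -143; 555; -172; -615; -977]; [0; 0; 0;
  0; 0; 0; 0; 0; 0; 0; 0; 0; 0; 673; 282; -718; 129; -167; -57; -217; -46; 311; 713; 382; -354; 516;
  -113; 87; -350; -314; 213; -202; -114; 114]; [0; 0; 0; 0; 0; 0; 0; 0; 0; 0; 0; 0; 0; 0; 1128; 327;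
  462; -432; -428; 18; -272; -282; -12; 1035; 805; 909; 170; 783; -437; -701; -324; 44; -219; -889];
  [0; 0; 0; 0; 0; 0; 0; 0; 0; 0; 0; 0; 0; 0; 0; 570; 177; -169; 57; -382; -125; 117; -13; -119; 850;
  389; 158; 296; -156; -315; -346; -396; -204; 286]; [0; 0; 0; 0; 0; 0; 0; 0; 0; 0; 0; 0; 0; 0; 0;
  0; 510; -202; 133; 140; -180; -231; 0; -30; 154; 675; -262; 321; 59; -192; -389; 74; -38; -124];
  [0; 0; 0; 0; 0; 0; 0; 0; 0; 0; 0; 0; 0; 0; 0; 0; 0; 369; -359; 234; -13; -201; -4; 66; -58; -30;
  134; -223; 344; -3; -181; 237; 13; -207]; [0; 0; 0; 0; 0; 0; 0; 0; 0; 0; 0; 0; 0; 0; 0; 0; 0; 0;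
  222; 103; 41; -81; -12; 105; 17; -52; -186; 81; 173; 131; -109; 74; 111; 31]; [0; 0; 0; 0; 0; 0;
  0; 0; 0; 0; 0; 0; 0; 0; 0; 0; 0; 0; 0; 867; 5; -897; -96; 246; 452; 41; -828; 117; 692; -69; -898;
  765; 419; -933]; [0; 0; 0; 0; 0; 0; 0; 0; 0; 0; 0; 0; 0; 0; 0; 0; 0; 0; 0; 0; 96; -11; 15; -57;
  -41; 36; 148; -44; -35; 74; 54; 11; 128; -171]; [0; 0; 0; 0; 0; 0; 0; 0; 0; 0; 0; 0; 0; 0; 0; 0;
  0; 0; 0; 0; 0; 99; -6; 17; 10; -21; -68; -2; -77; 39; 237; 31; -41; 70]; [0; 0; 0; 0; 0; 0; 0; 0;
  0; 0; 0; 0; 0; 0; 0; 0; 0; 0; 0; 0; 0; 0; 92; -129; -354; 42; 294; -98; -13; -39; 180; -14; 61;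
  -98]; [0; 0; 0; 0; 0; 0; 0; 0; 0; 0; 0; 0; 0; 0; 0; 0; 0; 0; 0; 0; 0; 0; 0; 325; -41; -91; -383;
  -523; 172; 84; -150; -26; 31; 349]; [0; 0; 0; 0; 0; 0; 0; 0; 0; 0; 0; 0; 0; 0; 0; 0; 0; 0; 0; 0;
  0; 0; 0; 0; 218; 172; 36; 119; -67; -82; -114; 13; -44; -77]; [0; 0; 0; 0; 0; 0; 0; 0; 0; 0; 0; 0;
  0; 0; 0; 0; 0; 0; 0; 0; 0; 0; 0; 0; 0; 165; -11; 95; 41; -203; 29; -8; 73; -133]; [0; 0; 0; 0; 0;
  0; 0; 0; 0; 0; 0; 0; 0; 0; 0; 0; 0; 0; 0; 0; 0; 0; 0; 0; 0; 0; 216; 151; -120; 37; 85; 19; -38;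
  -163]; [0; 0; 0; 0; 0; 0; 0; 0; 0; 0; 0; 0; 0; 0; 0; 0; 0; 0; 0; 0; 0; 0; 0; 0; 0; 0; 0; 454; -16;
  -87; 54; 20; -9; -226]; [0; 0; 0; 0; 0; 0; 0; 0; 0; 0; 0; 0; 0; 0; 0; 0; 0; 0; 0; 0; 0; 0; 0; 0;
  0; 0; 0; 0; 168; 10; -214; -31; 18; 80]; [0; 0; 0; 0; 0; 0; 0; 0; 0; 0; 0; 0; 0; 0; 0; 0; 0; 0; 0;
  0; 0; 0; 0; 0; 0; 0; 0; 0; 0; 164; 95; -2; -31; 110]; [0; 0; 0; 0; 0; 0; 0; 0; 0; 0; 0; 0; 0; 0;
  0; 0; 0; 0; 0; 0; 0; 0; 0; 0; 0; 0; 0; 0; 0; 0; 148; -5; 56; -40]; [0; 0; 0; 0; 0; 0; 0; 0; 0; 0;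
  0; 0; 0; 0; 0; 0; 0; 0; 0; 0; 0; 0; 0; 0; 0; 0; 0; 0; 0; 0; 0; 42; 37; -183]; [0; 0; 0; 0; 0; 0;
  0; 0; 0; 0; 0; 0; 0; 0; 0; 0; 0; 0; 0; 0; 0; 0; 0; 0; 0; 0; 0; 0; 0; 0; 0; 0; 49; 55]; [0; 0; 0;
  0; 0; 0; 0; 0; 0; 0; 0; 0; 0; 0; 0; 0; 0; 0; 0; 0; 0; 0; 0; 0; 0; 0; 0; 0; 0; 0; 0; 0; 0; 122]].
Definition cap_alt : list (list Z) :=
  [[129397; 432211; -20431; 559818; 942998; -475885; 18787; 519587; 3233357; 149192; 1429490;
  -548776; -178340; 67406; 2358349; 2100984; 2243310; -570453; 936812; -157118; -288869; -203289];
  [0; 1221; 998; 1903; 2665; 948; 698; 1094; 2400; 87; 3162; -594; -1158; 351; 1594; 767; 3790;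
  -1406; 592; -559; -1711; -1280]; [0; 0; 697; -94; 826; 629; 470; -52; -1384; 242; -198; -480; 61;
  119; -1744; -993; -1187; -314; -690; -492; -207; 11]; [0; 0; 0; 1184; 533; -286; -258; 2615; 2191;
  157; 312; -355; -313; 1659; 1626; 451; 1290; 256; -1098; -214; 368; 146]; [0; 0; 0; 0; 2200; 697;
  550; -254; 6373; 4147; 3444; 414; 1015; -556; 4014; 5413; 3931; 1230; 3225; -109; -123; -301]; [0;
  0; 0; 0; 0; 1219; 1239; 163; -953; 2336; 2327; 1542; 2124; 199; -1140; 39; 39; 1877; 2408; 389;
  687; 418]; [0; 0; 0; 0; 0; 0; 439; -58; -2948; -885; -979; 1561; 645; -17; -2608; -3037; -3225;
  -224; -173; 1501; 705; 961]; [0; 0; 0; 0; 0; 0; 0; 1292; -90; -487; 136; -405; -257; 936; -487;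
  628; -427; -740; 15; -368; -451; -586]; [0; 0; 0; 0; 0; 0; 0; 0; 1671; 734; 924; -632; -94; -60;
  1785; 1958; 1929; 147; 1307; -548; -495; -293]; [0; 0; 0; 0; 0; 0; 0; 0; 0; 852; 1024; 321; 963;
  -17; 10; 1105; 1214; 691; 2042; 301; 850; 459]; [0; 0; 0; 0; 0; 0; 0; 0; 0; 0; 288; -100; 145;
  -24; 104; 297; 479; -135; 348; -92; 41; -63]; [0; 0; 0; 0; 0; 0; 0; 0; 0; 0; 0; 506; 715; 82; 266;
  -558; -315; 332; 443; 481; 889; 549]; [0; 0; 0; 0; 0; 0; 0; 0; 0; 0; 0; 0; 570; -77; -67; 74;
  -278; -36; 479; 12; 485; 221]; [0; 0; 0; 0; 0; 0; 0; 0; 0; 0; 0; 0; 0; 181; 350; 38; 575; -38;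
  -103; -8; -35; 61]; [0; 0; 0; 0; 0; 0; 0; 0; 0; 0; 0; 0; 0; 0; 416; 177; 210; -205; 276; 43; -157;
  -132]; [0; 0; 0; 0; 0; 0; 0; 0; 0; 0; 0; 0; 0; 0; 0; 451; 528; -75; 17; -22; -44; 19]; [0; 0; 0;
  0; 0; 0; 0; 0; 0; 0; 0; 0; 0; 0; 0; 0; 178; 63; -151; -28; 58; 112]; [0; 0; 0; 0; 0; 0; 0; 0; 0;
  0; 0; 0; 0; 0; 0; 0; 0; 133; 151; -31; 78; 117]; [0; 0; 0; 0; 0; 0; 0; 0; 0; 0; 0; 0; 0; 0; 0; 0;
  0; 0; 276; 16; -46; 3]; [0; 0; 0; 0; 0; 0; 0; 0; 0; 0; 0; 0; 0; 0; 0; 0; 0; 0; 0; 41; -42; -157];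
  [0; 0; 0; 0; 0; 0; 0; 0; 0; 0; 0; 0; 0; 0; 0; 0; 0; 0; 0; 0; 104; 141]; [0; 0; 0; 0; 0; 0; 0; 0;
  0; 0; 0; 0; 0; 0; 0; 0; 0; 0; 0; 0; 0; 50]].
Definition det_triv : list (list Z) :=
  [[5541; 110915; -33585; 59020; -127255; -449020; -40620; -92296; -334759; 197196; 284393]; [0;
  10937; 77545; 94820; -43352; 34461; 48300; -52039; -174032; -373057; -349438]; [0; 0; 779; 892;
  -322; 814; 531; -412; -1382; -3943; -3833]; [0; 0; 0; 96; 60; -59; 19; 32; -286; -64; -149]; [0;
  0; 0; 0; 79; -91; 37; 134; 139; -221; -115]; [0; 0; 0; 0; 0; 30; 2; 10; -3; -22; -37]; [0; 0; 0;
  0; 0; 0; 21; 13; 40; -52; -39]; [0; 0; 0; 0; 0; 0; 0; 44; 33; -69; -16]; [0; 0; 0; 0; 0; 0; 0; 0;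
  65; -7; -53]; [0; 0; 0; 0; 0; 0; 0; 0; 0; 23; 12]; [0; 0; 0; 0; 0; 0; 0; 0; 0; 0; 41]].
Definition det_sign : list (list Z) :=
  [[77; 110]; [0; 52]].
Definition det_std : list (list Z) :=
  [[44629; -42132; 77348; -127838; 138298; -7384; -67667; -241639; -94767; 336965; 470478]; [0; 285;
  -1; 162; -90; -192; -94; 306; -379; -1086; -863]; [0; 0; 133; 35; 25; -93; 50; -552; -326; 156;
  430]; [0; 0; 0; 104; 66; -43; 98; 176; -35; -81; -75]; [0; 0; 0; 0; 124; 79; -1; -24; 69; 122;
  200]; [0; 0; 0; 0; 0; 38; 6; 27; 12; -51; -58]; [0; 0; 0; 0; 0; 0; 46; 26; 27; -68; 62]; [0; 0; 0;
  0; 0; 0; 0; 190; 46; 3; 2]; [0; 0; 0; 0; 0; 0; 0; 0; 70; 82; 111]; [0; 0; 0; 0; 0; 0; 0; 0; 0; 89;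
  24]; [0; 0; 0; 0; 0; 0; 0; 0; 0; 0; 58]].
Definition pair_sos : list (list Z) :=
  [[17790; -203077; -105797; 2309058; 994693; -5523959; -4350668]; [0; 13024; -104167; -432591;
  214563; 1459342; 933694]; [0; 0; 3562; 10082; -9025; -38998; -23552]; [0; 0; 0; 607; 243; -2040;
  -1694]; [0; 0; 0; 0; 231; -22; -276]; [0; 0; 0; 0; 0; 336; 349]; [0; 0; 0; 0; 0; 0; 47]].
Definition pair_cap : list (list Z) :=
  [[48001; -276920; -2240567; -4068144; -2565380; -408835]; [0; 7684; -45920; -346574; -566973;
  -274849]; [0; 0; 4353; 20983; 30897; 14303]; [0; 0; 0; 1756; 4867; 3248]; [0; 0; 0; 0; 1151;
  1347]; [0; 0; 0; 0; 0; 181]].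

End Certificate.

Module ContactBound.
Import Ring_polynom structures.
Import all_boot all_order all_algebra all_classical all_reals all_analysis measurable_realfun.
Import Rstruct Rstruct_topology ssrZ zify ring lra.
Import Certificate.
Set Implicit Arguments. Unset Strict Implicit. Unset Printing Implicit Defensive.
Import Order.TTheory GRing.Theory Num.Theory.
Import numFieldNormedType.Exports.
Local Open Scope classical_set_scope.
Local Open Scope ring_scope.

(** The Horner normal form behind the [ring] tactic, used as a polynomial expander that comes with a
    correctness theorem and runs under [vm_compute]. *)
Definition pol_of (e : PExpr Z) : Pol Z :=
  norm_aux Z0 (Zpos xH) Z.add Z.mul Z.sub Z.opp Z.eqb e.

Fixpoint abs_sum (P : Pol Z) : Z :=
  match P with
  | Pc c => Z.abs c
  | Ring_polynom.Pinj _ Q => abs_sum Q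
  | PX P1 _ Q => Z.add (abs_sum P1) (abs_sum Q)
  end.

(** [PX P1 i Q] stands for P1 x^i + Q with [Q] free of the first variable x, so the constant term
    sits in [Q] and every coefficient of [P1] is charged in absolute value. *)
Fixpoint box_lower_bound (P : Pol Z) : Z :=
  match P with
  | Pc c => c
  | Ring_polynom.Pinj _ Q => box_lower_bound Q
  | PX P1 _ Q => Z.sub (box_lower_bound Q) (abs_sum P1)
  end.

(** * Polynomial inequalities on the box [-1, 1]^n *)

Section Eval.
Variable R : realFieldType.
Implicit Types (l : list R) (e : PExpr Z) (P : Pol Z).

(* Locked because unfolding it converts large binary integers to unary ones. *)
Fact Zembed_key : unit. Proof. exact: tt. Qed.
Definition Zembed : Z -> R := locked_with Zembed_key (fun z => (int_of_Z z)%:~R).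
Lemma ZembedE z : Zembed z = (int_of_Z z)%:~R. Proof. by rewrite /Zembed unlock. Qed.

Lemma Zembed0 : Zembed Z0 = 0. Proof. by rewrite ZembedE. Qed.
Lemma ZembedD x y : Zembed (Z.add x y) = Zembed x + Zembed y.
Proof. by rewrite !ZembedE -rmorphD -rmorphD. Qed.
Lemma ZembedM x y : Zembed (Z.mul x y) = Zembed x * Zembed y.
Proof. by rewrite !ZembedE -rmorphM -rmorphM. Qed.
Lemma ZembedN x : Zembed (Z.opp x) = - Zembed x.
Proof. by rewrite !ZembedE -rmorphN -rmorphN. Qed.
Lemma ZembedB x y : Zembed (Z.sub x y) = Zembed x - Zembed y.
Proof. by rewrite -ZembedN -ZembedD. Qed.
Lemma Zembed_le x y : Z.leb x y -> Zembed x <= Zembed y.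
Proof. by move=> h; rewrite !ZembedE ler_int; lia. Qed.
Lemma Zembed_abs x : Zembed (Z.abs x) = `|Zembed x|.
Proof. by rewrite !ZembedE -intr_norm; congr (_%:~R); lia. Qed.

Definition peval l e : R :=
  PEeval 0 1 +%R *%R (fun x y => x - y) -%R Zembed id (pow_N 1 *%R) l e.
Definition poleval l P : R := Pphi 0 +%R *%R Zembed l P.

Lemma mc_ring_theory : ring_theory (0 : R) 1 +%R *%R (fun x y => x - y) -%R eq.
Proof.
split=> *; rewrite ?add0r ?mul1r ?subrr ?mulrDl //;
  by [rewrite addrC | rewrite addrA | rewrite mulrC | rewrite mulrA].
Qed.

Lemma peval_pol l e : peval l e = poleval l (pol_of e).
Proof.
have st : RelationClasses.Equivalence (@eq R) by split=> // x y z ->.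
have ex : ring_eq_ext +%R *%R -%R (@eq R) by split=> ? ? -> // ? ? ->.
apply: (@norm_aux_spec R 0 1 _ _ _ _ _ st ex (Rth_ARth st ex mc_ring_theory)) => //.
split; [by rewrite ZembedE | by rewrite ZembedE | exact: ZembedD |
   exact: ZembedB | exact: ZembedM | exact: ZembedN |].
by move=> x y /Z.eqb_spec ->.
Qed.

Definition in_box l := all (fun x => `|x| <= 1) l.

Lemma in_box_tl l : in_box l -> in_box (List.tl l).
Proof. by case: l => //= x l /andP[]. Qed.

Lemma in_box_jump j l : in_box l -> in_box (BinList.jump j l).
Proof.
elim: j l => [j IH|j IH|] l h /=.
- exact/IH/IH/in_box_tl.
- exact/IH/IH.
- exact: in_box_tl.
Qed.

(** Missing variables are read as the default 0, which also lies in [-1, 1]. *)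
Lemma in_box_hd l : in_box l -> `|List.hd 0 l| <= 1.
Proof. by case: l => [|x l] /=; rewrite ?normr0 ?ler01 // => /andP[]. Qed.

Lemma pow_pos_box (x : R) i : `|x| <= 1 -> `|pow_pos *%R x i| <= 1.
Proof.
by move=> h; elim: i => [j IH|j IH|] //=; rewrite !normrM !mulr_ile1 ?mulr_ge0.
Qed.

Lemma poleval_abs_sum P l : in_box l -> `|poleval l P| <= Zembed (abs_sum P).
Proof.
elim: P l => [c|j Q IH|P1 IH1 i Q IH2] l h /=.
- by rewrite /poleval /= Zembed_abs.
- exact/IH/in_box_jump.
rewrite ZembedD /poleval /=; apply: le_trans (ler_normD _ _) _; apply: lerD.
  rewrite normrM -[leRHS]mulr1; apply: ler_pM => //; first exact: IH1.
  exact/pow_pos_box/in_box_hd.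
exact/IH2/in_box_tl.
Qed.

Lemma poleval_lower_bound P l : in_box l -> Zembed (box_lower_bound P) <= poleval l P.
Proof.
elim: P l => [c|j Q IH|P1 IH1 i Q IH2] l h //=.
  exact/IH/in_box_jump.
rewrite ZembedB /poleval /= addrC; apply: lerD; last exact/IH2/in_box_tl.
rewrite lerNl; apply: le_trans (ler_norm _) _.
rewrite normrN normrM -[leRHS]mulr1; apply: ler_pM => //; first exact: poleval_abs_sum.
exact/pow_pos_box/in_box_hd.
Qed.

(** Reduces nonnegativity on the whole box to one computation with integers. *)
Lemma peval_ge0 l e : in_box l -> Z.leb Z0 (box_lower_bound (pol_of e)) -> 0 <= peval l e.
Proof.
move=> h /Zembed_le; rewrite peval_pol => h0.
by apply: le_trans (poleval_lower_bound _ h); rewrite ZembedE in h0.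
Qed.
End Eval.

(** * The three-point certificate *)

Definition pe0 : PExpr Z := PEc Z0.
Definition pe1 : PExpr Z := PEc (Zpos xH).

Definition pe_sum (s : seq (PExpr Z)) : PExpr Z := foldr (@PEadd Z) pe0 s.
Definition pe_comb (r : seq Z) (b : seq (PExpr Z)) : PExpr Z :=
  pe_sum [seq PEmul (PEc x.1) x.2 | x <- zip r b].
Definition pe_sumsq (rows : seq (seq Z)) (b : seq (PExpr Z)) : PExpr Z :=
  pe_sum [seq PEmul p p | p <- [seq pe_comb r b | r <- rows]].
Definition pe_sos (s : seq (seq (seq Z) * seq (PExpr Z))) : PExpr Z :=
  pe_sum [seq pe_sumsq x.1 x.2 | x <- s].
Definition pe_pow (x : PExpr Z) (n : nat) : PExpr Z := iter n (PEmul x) pe1.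
Definition pe_horner (r : seq Z) (x : PExpr Z) : PExpr Z :=
  foldr (fun c e => PEadd (PEc c) (PEmul x e)) pe0 r.

(** [q0] and [q1] run through consecutive homogenized Chebyshev polynomials p^(k/2) T_k(s / sqrt p),
    the zonal functions of the circle. The k-th one is weighted by the kernel that the k-th Cholesky
    factor defines in [u] and [v]. *)
Fixpoint pe_zonal (M : seq (seq (seq Z))) (s p u v q0 q1 : PExpr Z) : PExpr Z :=
  if M is rows :: M' then
    PEadd (PEmul (pe_sum [seq PEmul (pe_horner r u) (pe_horner r v) | r <- rows]) q0)
          (pe_zonal M' s p u v q1 (PEsub (PEmul (PEadd s s) q1) (PEmul p q0)))
  else pe0.

Definition pe_zonal_cert (u v t : PExpr Z) : PExpr Z :=
  let s := PEsub t (PEmul u v) in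
  pe_zonal zonal_rows s (PEmul (PEsub pe1 (PEmul u u)) (PEsub pe1 (PEmul v v))) u v pe1 s.

(** The order, by total degree and then lexicographically decreasing, fixes which monomials the
    columns of the data refer to. *)
Definition exps (d : nat) : seq (nat * nat * nat) :=
  flatten [seq flatten [seq [seq (i, j, (t - i - j)%N) | j <- rev (iota 0 (t - i).+1)]
    | i <- rev (iota 0 t.+1)] | t <- iota 0 d.+1].

Section Basis.
Variables u v t : PExpr Z.

Definition mono (i j k : nat) : PExpr Z :=
  PEmul (pe_pow u i) (PEmul (pe_pow v j) (pe_pow t k)).
Definition mono2 (i j k : nat) : PExpr Z := PEadd (mono i j k) (mono j i k).

Definition orbit_exps (d : nat) := [seq e <- exps d | (e.1.2 <= e.1.1)%N && (e.2 <= e.1.2)%N].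

(* Bases of the polynomials invariant under the permutations of u, v, t, of the alternating ones,
   and, for the two-dimensional representation of S_3, of its vectors fixed by u <-> v. *)
Definition basis_triv (d : nat) := [seq let: (i, j, k) := e in
   pe_sum [:: mono2 i j k; mono2 j k i; mono2 k i j] | e <- orbit_exps d].
Definition basis_sign (d : nat) := [seq let: (i, j, k) := e in
   PEsub (pe_sum [:: mono i j k; mono j k i; mono k i j])
         (pe_sum [:: mono j i k; mono i k j; mono k j i])
  | e <- orbit_exps d & (e.1.2 < e.1.1)%N && (e.2 < e.1.2)%N].
Definition basis_std (d : nat) := flatten [seq let: (i, j, k) := e in
   (if (j < i)%N then [:: PEsub (mono2 j k i) (mono2 i k j)] else [::]) ++
   (if (k < j)%N then [:: PEsub (mono2 i k j) (mono2 i j k)] else [::])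
  | e <- orbit_exps d].
(* The polynomials symmetric, respectively antisymmetric, under v <-> t. *)
Definition basis_sym (d : nat) := [seq let: (i, j, k) := e in
   PEadd (mono i j k) (mono i k j) | e <- exps d & (e.2 <= e.1.2)%N].
Definition basis_alt (d : nat) := [seq let: (i, j, k) := e in
   PEsub (mono i j k) (mono i k j) | e <- exps d & (e.2 < e.1.2)%N].

Definition pe_cap (x : PExpr Z) : PExpr Z :=
  PEmul (PEadd x pe1) (PEsub pe1 (PEadd x x)).
(** The Gram determinant of three unit vectors with inner products [u], [v], [t]. *)
Definition pe_det : PExpr Z :=
  PEsub (PEadd pe1 (PEmul (PEadd u u) (PEmul v t)))
    (PEadd (PEmul u u) (PEadd (PEmul v v) (PEmul t t))).

End Basis.

(* The certificate is for the multiplier (u + 1)(1/2 - u), of which [pe_cap u] is the double. *)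
Definition pe_mult (S0 g1 S1 g2 S2 : PExpr Z) : PExpr Z :=
  PEadd (PEadd S0 S0) (PEadd (PEmul g1 S1) (PEmul g2 (PEadd S2 S2))).

Definition pe_sos_cert (u v t : PExpr Z) : PExpr Z := pe_mult
  (pe_sos [:: (sos_triv, basis_triv u v t 6); (sos_sign, basis_sign u v t 6);
              (sos_std, basis_std u v t 6)])
  (pe_cap u) (pe_sos [:: (cap_sym, basis_sym u v t 5); (cap_alt, basis_alt u v t 5)])
  (pe_det u v t) (pe_sos [:: (det_triv, basis_triv u v t 4); (det_sign, basis_sign u v t 4);
              (det_std, basis_std u v t 4)]).

Definition X1 : PExpr Z := PEX Z 1.
Definition X2 : PExpr Z := PEX Z 2.
Definition X3 : PExpr Z := PEX Z 3.

Definition pe_cyc (f : PExpr Z -> PExpr Z -> PExpr Z -> PExpr Z) (a b c : PExpr Z) :=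
  PEadd (f a b c) (PEadd (f b c a) (f c a b)).
(** The first argument is doubled to match [pe_mult], which is twice the combination of squares it
    encodes; this keeps the coefficients integral. *)
Definition pe_neg (a b : PExpr Z) : PExpr Z := PEopp (PEadd (PEadd a a) b).

(** The unit of the certificate: factors at scale 2^20 enter through products of two. *)
Definition pe_scale : PExpr Z := PEc (Z.pow_pos (Zpos 2) 40).

Definition pe_triple : PExpr Z :=
  pe_neg (pe_cyc pe_zonal_cert X1 X2 X3) (pe_cyc pe_sos_cert X1 X2 X3).

(** Triples with exactly two equal points have inner products [X1], [X1], 1. Adding [pe_scale] asks
    the kernel to be at most minus one unit there. *)
Definition pe_pair : PExpr Z :=
  let basis d := [seq pe_pow X1 n | n <- iota 0 d.+1] in
  pe_neg (PEadd pe_scale (pe_cyc pe_zonal_cert X1 X1 pe1))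
    (pe_mult (pe_sumsq pair_sos (basis 6)) (pe_cap X1) (pe_sumsq pair_cap (basis 5)) pe0 pe0).

(** The added 1 makes the resulting inequality strict. *)
Definition pe_diag : PExpr Z :=
  PEsub (PEmul (PEc (Zpos 12)) pe_scale) (PEadd pe1 (pe_zonal_cert pe1 pe1 pe1)).

Lemma triple_check : Z.leb Z0 (box_lower_bound (pol_of pe_triple)).
Proof. by vm_compute. Qed.
Lemma pair_check : Z.leb Z0 (box_lower_bound (pol_of pe_pair)).
Proof. by vm_compute. Qed.
Lemma diag_check : Z.leb Z0 (box_lower_bound (pol_of pe_diag)).
Proof. by vm_compute. Qed.

Section Certificate.
Variable R : realFieldType.
Implicit Types (l : seq R) (M : seq (seq (seq Z))).

Definition horner_list (r : seq Z) (u : R) : R := foldr (fun c e => Zembed R c + u * e) 0 r.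

Fixpoint zonal M (s p u v q0 q1 : R) : R :=
  if M is rows :: M' then
    (\sum_(r <- rows) horner_list r u * horner_list r v) * q0
      + zonal M' s p u v q1 ((s + s) * q1 - p * q0)
  else 0.

Definition zonal_cert (u v t : R) : R :=
  zonal zonal_rows (t - u * v) ((1 - u * u) * (1 - v * v)) u v 1 (t - u * v).

Lemma pevalD l a b : peval l (PEadd a b) = peval l a + peval l b. Proof. by []. Qed.
Lemma pevalM l a b : peval l (PEmul a b) = peval l a * peval l b. Proof. by []. Qed.
Lemma pevalB l a b : peval l (PEsub a b) = peval l a - peval l b. Proof. by []. Qed.
Lemma peval1 l : peval l pe1 = 1. Proof. by rewrite -[LHS]/(Zembed R (Zpos xH)) ZembedE. Qed.
Lemma peval_horner l r e : peval l (pe_horner r e) = horner_list r (peval l e).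
Proof. by elim: r => [|c r /= <-] //; exact: Zembed0. Qed.

Lemma peval_zonal l M s p u v q0 q1 :
  peval l (pe_zonal M s p u v q0 q1) =
  zonal M (peval l s) (peval l p) (peval l u) (peval l v) (peval l q0) (peval l q1).
Proof.
elim: M q0 q1 => [|rows M IH] q0 q1; first exact: Zembed0.
rewrite -[LHS]/(_ * _ + peval l _) IH; congr (_ * _ + _).
elim: rows => [|r rows IHr]; rewrite ?big_nil ?big_cons; first exact: Zembed0.
rewrite -IHr.
by rewrite -[LHS]/(peval l _ * peval l _ + _) !peval_horner.
Qed.

Lemma peval_zonal_cert l u v t :
  peval l (pe_zonal_cert u v t) = zonal_cert (peval l u) (peval l v) (peval l t).
Proof. by rewrite /pe_zonal_cert peval_zonal /zonal_cert !(pevalB, pevalM, peval1). Qed.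

Lemma peval_sumsq_ge0 l rows b : 0 <= peval l (pe_sumsq rows b).
Proof.
rewrite /pe_sumsq; elim: rows => [|r rows IH]; first by rewrite -[leRHS]/(Zembed R Z0) Zembed0.
rewrite -[leRHS]/(peval l _ * peval l _ + peval l _).
by rewrite -expr2 addr_ge0 // sqr_ge0.
Qed.

Lemma peval_capE l a : peval l (pe_cap a) = (peval l a + 1) * (1 - (peval l a + peval l a)).
Proof. by rewrite pevalM pevalB !pevalD peval1. Qed.
Lemma peval_detE l a b c : let u := peval l a in let v := peval l b in let t := peval l c in
  peval l (pe_det a b c) = 1 + 2 * u * v * t - u ^+ 2 - v ^+ 2 - t ^+ 2.
Proof. by move=> u v t; rewrite pevalB !pevalD !pevalM peval1 !pevalD -/u -/v -/t; ring. Qed.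

Lemma peval_sos_ge0 l s : 0 <= peval l (pe_sos s).
Proof.
rewrite /pe_sos; elim: s => [|x s IH]; first by rewrite -[leRHS]/(Zembed R Z0) Zembed0.
by rewrite -[leRHS]/(peval l _ + peval l _) addr_ge0 // peval_sumsq_ge0.
Qed.

Lemma peval_mult_ge0 l S0 g1 S1 g2 S2 :
  0 <= peval l S0 -> 0 <= peval l S1 -> 0 <= peval l S2 ->
  0 <= peval l g1 -> 0 <= peval l g2 -> 0 <= peval l (pe_mult S0 g1 S1 g2 S2).
Proof.
by move=> *; rewrite /pe_mult !(pevalD, pevalM); do ?[apply: addr_ge0 | apply: mulr_ge0].
Qed.

Lemma peval_neg l a b : peval l (pe_neg a b) = - (peval l a + peval l a + peval l b).
Proof. by []. Qed.

Lemma peval_cyc l f a b c : peval l (pe_cyc f a b c) =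
  peval l (f a b c) + (peval l (f b c a) + peval l (f c a b)).
Proof. by []. Qed.

Lemma peval_sos_cert_ge0 l a b c :
  0 <= peval l (pe_cap a) -> 0 <= peval l (pe_det a b c) -> 0 <= peval l (pe_sos_cert a b c).
Proof. by apply: peval_mult_ge0; apply: peval_sos_ge0. Qed.

(** By [triple_check], twice the left side is at most minus the cyclic sum of the [pe_sos_cert]
    values. These are nonnegative: the cap factors are so on [-1, 1/2], and the determinant, which
    is invariant under cyclic shifts, by assumption. *)
Lemma zonal_cert_triple (u v t : R) : -1 <= u <= 2^-1 -> -1 <= v <= 2^-1 -> -1 <= t <= 2^-1 ->
  0 <= 1 + 2 * u * v * t - u ^+ 2 - v ^+ 2 - t ^+ 2 ->
  zonal_cert u v t + (zonal_cert v t u + zonal_cert t u v) <= 0.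
Proof.
move=> hu hv ht hd; pose l := [:: u; v; t].
have box : in_box l by rewrite /= !ler_norml; lra.
have cap (x : R) : -1 <= x <= 2^-1 -> 0 <= (x + 1) * (1 - (x + x)).
  by move=> h; apply: mulr_ge0; lra.
have W1 : 0 <= peval l (pe_sos_cert X1 X2 X3).
  by apply: peval_sos_cert_ge0; rewrite ?peval_capE ?peval_detE; [exact: (cap u) | exact: hd].
have W2 : 0 <= peval l (pe_sos_cert X2 X3 X1).
  apply: peval_sos_cert_ge0; rewrite ?peval_capE ?peval_detE; first exact: (cap v).
  by apply: le_trans hd _; rewrite le_eqVlt; apply/orP; left; apply/eqP; rewrite /=; ring.
have W3 : 0 <= peval l (pe_sos_cert X3 X1 X2).
  apply: peval_sos_cert_ge0; rewrite ?peval_capE ?peval_detE; first exact: (cap t).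
  by apply: le_trans hd _; rewrite le_eqVlt; apply/orP; left; apply/eqP; rewrite /=; ring.
have := peval_ge0 box triple_check.
rewrite /pe_triple peval_neg (peval_cyc l pe_zonal_cert) (peval_cyc l pe_sos_cert).
rewrite (peval_zonal_cert l X1) (peval_zonal_cert l X2) (peval_zonal_cert l X3).
have -> : peval l X1 = u by []. have -> : peval l X2 = v by []. have -> : peval l X3 = t by [].
(* Generalizing the certificate values leaves [lra] a problem in plain variables. *)
move: (zonal_cert u v t) (zonal_cert v t u) (zonal_cert t u v)
  (peval l _) (peval l _) (peval l _) W1 W2 W3 => *.
by lra.
Qed.

Definition scale : R := peval [::] pe_scale.

Lemma scale_gt0 : 0 < scale.
Proof. by apply: (@lt_le_trans _ _ (Zembed R (Zpos xH))); [rewrite ZembedE | exact: Zembed_le]. Qed.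

Lemma zonal_cert_pair (u : R) : -1 <= u <= 2^-1 ->
  zonal_cert u u 1 + (zonal_cert u 1 u + zonal_cert 1 u u) <= - scale.
Proof.
move=> hu; pose l := [:: u].
have box : in_box l by rewrite /= ler_norml; lra.
have := peval_ge0 box pair_check.
rewrite /pe_pair peval_neg pevalD (peval_cyc l pe_zonal_cert) !(peval_zonal_cert l).
have -> : peval l X1 = u by []. have -> : peval l pe_scale = scale by [].
rewrite peval1; set m := peval l (pe_mult _ _ _ _ _).
have hm : 0 <= m.
  apply: peval_mult_ge0; rewrite ?peval_capE ?peval_sumsq_ge0 //.
  - by rewrite -[leRHS]/(Zembed R Z0) Zembed0.
  - by have -> : peval l X1 = u by []; apply: mulr_ge0; lra.
  - by rewrite -[leRHS]/(Zembed R Z0) Zembed0.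
by move: (zonal_cert _ _ _) (zonal_cert _ _ _) (zonal_cert _ _ _) m hm scale => *; lra.
Qed.

Lemma zonal_cert_diag : zonal_cert 1 1 1 < 12 * scale.
Proof.
(* [pe_diag] is a constant expression, so the empty evaluation point suffices. *)
have := @peval_ge0 R [::] pe_diag isT diag_check.
rewrite pevalB pevalM pevalD peval_zonal_cert !peval1 -[peval _ pe_scale]/scale.
have -> : peval [::] (PEc (Zpos 12)) = 12 :> R by rewrite -[LHS]/(Zembed R (Zpos 12)) ZembedE.
by move: (zonal_cert _ _ _) scale => *; lra.
Qed.

End Certificate.

(** * The kissing number *)

(** Vectors are right-nested pairs, the shape in which [volume] is built as a product of line and
    plane. *)
Definition dot (R : rcfType) (x y : R * (R * R)) : R :=
  x.1 * y.1 + (x.2.1 * y.2.1 + x.2.2 * y.2.2).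

Section Kissing.
Variable R : rcfType.
Local Notation vec := (R * (R * R))%type.
Implicit Types x y z : vec.

Lemma dotC x y : dot x y = dot y x.
Proof. by rewrite /dot; ring. Qed.

(** Completes [z] to an orthonormal frame, recorded only through Parseval's identity. *)
Lemma frame_exists z : dot z z = 1 ->
  exists e1 e2 : vec, forall x y,
    dot x y = dot x z * dot y z + dot x e1 * dot y e1 + dot x e2 * dot y e2.
Proof.
case: z => a [b c]; rewrite /dot /= => h.
have [ab0|abN0] := eqVneq (a ^+ 2 + b ^+ 2) 0.
  (* At a pole [z] is plus or minus the third basis vector, and the other two complete the frame. *)
  have [a0 b0] : a = 0 /\ b = 0.
    by split; apply/eqP; rewrite -sqrf_eq0; apply/eqP; nra.
  exists (1, (0, 0)), (0, (1, 0)) => x y /=.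
  have : c * c = 1 by rewrite -h a0 b0; ring.
  by move=> cc; rewrite a0 b0; ring: cc.
set r := Num.sqrt (a ^+ 2 + b ^+ 2).
have r2 : r ^+ 2 = a ^+ 2 + b ^+ 2 by rewrite sqr_sqrtr // addr_ge0 ?sqr_ge0.
have r0 : r != 0 by rewrite -sqrf_eq0 r2.
(* The horizontal unit vector orthogonal to [z], and its cross product with [z]. *)
exists (- b / r, (a / r, 0)), (- a * c / r, (- b * c / r, r)) => -[x1 [x2 x3]] [y1 [y2 y3]] /=.
have c2 : c ^+ 2 = 1 - r ^+ 2 by rewrite r2 -h; ring.
apply: (mulfI (expf_neq0 2 r0)).
have -> : forall u v w, r ^+ 2 * (u + v + w) = r ^+ 2 * u + r ^+ 2 * v + r ^+ 2 * w.
  by move=> *; ring.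
have -> : r ^+ 2 * ((x1 * (- b / r) + (x2 * (a / r) + x3 * 0)) *
     (y1 * (- b / r) + (y2 * (a / r) + y3 * 0))) = (x2 * a - x1 * b) * (y2 * a - y1 * b) by field.
have -> : r ^+ 2 * ((x1 * (- a * c / r) + (x2 * (- b * c / r) + x3 * r)) *
     (y1 * (- a * c / r) + (y2 * (- b * c / r) + y3 * r))) =
   (x3 * r ^+ 2 - c * (x1 * a + x2 * b)) * (y3 * r ^+ 2 - c * (y1 * a + y2 * b)) by field.
rewrite r2; rewrite r2 in c2.
by ring: c2.
Qed.

(* With w = (al, be) and z = (a, b) in the complex plane, the recursion runs through the kernels
   Re (z_i w_i^k conj (z_j w_j^k)), which are positive semidefinite. *)
Lemma zonal_psd (I : finType) (u al be a b : I -> R) (M : seq (seq (seq Z))) :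
  0 <= \sum_i \sum_j zonal M (al i * al j + be i * be j)
    ((al i ^+ 2 + be i ^+ 2) * (al j ^+ 2 + be j ^+ 2)) (u i) (u j)
    (a i * a j + b i * b j)
    ((a i * al i - b i * be i) * (a j * al j - b j * be j)
      + (a i * be i + b i * al i) * (a j * be j + b j * al j)).
Proof.
elim: M a b => [|rows M IH] a b /=.
  by rewrite big1 // => i _; rewrite big1.
under eq_bigr do rewrite big_split /=.
rewrite big_split /=; apply: addr_ge0; last first.
  have := IH (fun i => a i * al i - b i * be i) (fun i => a i * be i + b i * al i).
  move/le_trans; apply; rewrite le_eqVlt; apply/orP; left; apply/eqP.
  by apply: eq_bigr => i _; apply: eq_bigr => j _; congr zonal; ring.
have -> : \sum_i \sum_j (\sum_(r <- rows) horner_list r (u i) * horner_list r (u j))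
    * (a i * a j + b i * b j) =
  \sum_(r <- rows) ((\sum_i horner_list r (u i) * a i) ^+ 2
    + (\sum_i horner_list r (u i) * b i) ^+ 2).
  under [RHS]eq_bigr do rewrite !expr2 !big_distrlr -big_split /=.
  rewrite [RHS]exchange_big /=; apply: eq_bigr => i _.
  under [RHS]eq_bigr do rewrite -big_split /=.
  rewrite [RHS]exchange_big /=; apply: eq_bigr => j _.
  by rewrite mulr_suml; apply: eq_bigr => r _; ring.
by apply: sumr_ge0 => r _; rewrite addr_ge0 ?sqr_ge0.
Qed.

Lemma sum_cyc (I : finType) (f : I -> I -> I -> R) :
  \sum_i \sum_j \sum_k (f i j k + (f k i j + f j k i)) =
  \sum_i \sum_j \sum_k f i j k +
    (\sum_i \sum_j \sum_k f i j k + \sum_i \sum_j \sum_k f i j k).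
Proof.
under eq_bigr do under eq_bigr do rewrite !big_split /=.
under eq_bigr do rewrite !big_split /=.
rewrite !big_split /=; congr (_ + (_ + _)).
  under eq_bigr do rewrite exchange_big /=.
  by rewrite [LHS]exchange_big.
rewrite [LHS]exchange_big /=; apply: eq_bigr => j _.
by rewrite [LHS]exchange_big.
Qed.

Section Config.
Variables (N : nat) (x : 'I_N -> vec).
Hypothesis unit_x : forall i, dot (x i) (x i) = 1.
Hypothesis sep_x : forall i j, i != j -> dot (x i) (x j) <= 2^-1.
Let g i j := dot (x i) (x j).

(** With [x k] as pole, [g i j - g i k * g j k] is the inner product of the projections to the
    orthogonal plane, which is the form of [zonal_psd] started at the complex number 1. *)
Lemma zonal_cert_psd k : 0 <= \sum_i \sum_j zonal_cert (g i k) (g j k) (g i j).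
Proof.
have [e1 [e2 fr]] := frame_exists (unit_x k).
have := zonal_psd (fun i => g i k) (fun i => dot (x i) e1) (fun i => dot (x i) e2)
  (fun=> 1) (fun=> 0) zonal_rows.
move/le_trans; apply; rewrite le_eqVlt; apply/orP; left; apply/eqP.
apply: eq_bigr => i _; apply: eq_bigr => j _; rewrite /zonal_cert.
have e i' : dot (x i') e1 ^+ 2 + dot (x i') e2 ^+ 2 = 1 - g i' k * g i' k.
  by have := fr (x i') (x i'); rewrite unit_x /g => ->; ring.
have eg : g i j - g i k * g j k = dot (x i) e1 * dot (x j) e1 + dot (x i) e2 * dot (x j) e2.
  by rewrite /g fr; ring.
by rewrite !e eg; congr zonal; ring.
Qed.

Let g_ge i j : -1 <= g i j.
Proof.
have := unit_x i; have := unit_x j; rewrite /g /dot => h1 h2.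
have := sqr_ge0 ((x i).1 + (x j).1); have := sqr_ge0 ((x i).2.1 + (x j).2.1).
have := sqr_ge0 ((x i).2.2 + (x j).2.2); nra.
Qed.

Let g_cap i j : i != j -> -1 <= g i j <= 2^-1.
Proof. by move=> h; rewrite g_ge sep_x. Qed.

(** The determinant equals the squared area spanned by the projections of [x i] and [x j] to the
    plane orthogonal to [x k]. *)
Lemma gram_det_ge0 i j k :
  0 <= 1 + 2 * g i k * g j k * g i j - g i k ^+ 2 - g j k ^+ 2 - g i j ^+ 2.
Proof.
have [e1 [e2 fr]] := frame_exists (unit_x k).
have e i' : 1 - g i' k * g i' k = dot (x i') e1 ^+ 2 + dot (x i') e2 ^+ 2.
  by have := fr (x i') (x i'); rewrite unit_x /g => ->; ring.
have eg : g i j - g i k * g j k = dot (x i) e1 * dot (x j) e1 + dot (x i) e2 * dot (x j) e2.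
  by rewrite /g fr; ring.
rewrite [leRHS](_ : _ = (1 - g i k * g i k) * (1 - g j k * g j k)
  - (g i j - g i k * g j k) ^+ 2); last by ring.
rewrite !e eg; apply: le_trans (sqr_ge0
  (dot (x i) e1 * dot (x j) e2 - dot (x j) e1 * dot (x i) e2)) _.
by rewrite le_eqVlt; apply/orP; left; apply/eqP; ring.
Qed.

Let cyc_cert i j k := zonal_cert (g i k) (g j k) (g i j) +
  (zonal_cert (g j k) (g i j) (g i k) + zonal_cert (g i j) (g i k) (g j k)).

(** One bound for all coincidence patterns: 0 for distinct indices, [- scale R] for exactly one
    coincidence, and equality with 3 [zonal_cert 1 1 1] when all three agree. *)
Lemma cyc_cert_le i j k : cyc_cert i j k <=
  - scale R * ((i == j)%:R + (j == k)%:R + (i == k)%:R)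
  + 3 * (zonal_cert 1 1 1 + scale R) * ((i == j) && (j == k))%:R.
Proof.
have gC a b : g a b = g b a by exact: dotC.
have g1 a : g a a = 1 by exact: unit_x.
have [->|ij] := eqVneq i j; have [<-|jk] := eqVneq j k.
- by rewrite ?eqxx /cyc_cert !g1 /= !mulr1; move: (zonal_cert 1 1 1) (scale R) => *; lra.
- rewrite ?(negbTE jk) /= /cyc_cert !g1; have := zonal_cert_pair (g_cap jk).
  by move: (zonal_cert _ _ _) (zonal_cert _ _ _) (zonal_cert _ _ _) (scale R) => *; lra.
- rewrite ?(negbTE ij) /= /cyc_cert !g1; have := zonal_cert_pair (g_cap ij).
  by move: (zonal_cert _ _ _) (zonal_cert _ _ _) (zonal_cert _ _ _) (scale R) => *; lra.
have [ik|ik] := eqVneq i k.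
  rewrite ik in ij *; rewrite /= /cyc_cert !g1 ?(gC j k); have := zonal_cert_pair (g_cap ij).
  by move: (zonal_cert _ _ _) (zonal_cert _ _ _) (zonal_cert _ _ _) (scale R) => *; lra.
have := zonal_cert_triple (g_cap ik) (g_cap jk) (g_cap ij) (gram_det_ge0 i j k).
rewrite /cyc_cert /=.
by move: (zonal_cert _ _ _) (zonal_cert _ _ _) (zonal_cert _ _ _) (scale R) => *; lra.
Qed.

(** With s = [scale R] and f = [zonal_cert 1 1 1], summing [cyc_cert_le] over all triples bounds 3 S
    by - 3 s N^2 + 3 (f + s) N, while S >= 0 by semidefiniteness. Hence s N <= f + s < 13 s. *)
Lemma kissing_le : (N <= 12)%N.
Proof.
set S := \sum_i \sum_j \sum_k zonal_cert (g i k) (g j k) (g i j).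
have S0 : 0 <= S.
  rewrite /S; under eq_bigr do rewrite exchange_big /=.
  by rewrite exchange_big /=; apply: sumr_ge0 => k _; exact: zonal_cert_psd.
have gC a b : g a b = g b a by exact: dotC.
have S3 : \sum_i \sum_j \sum_k cyc_cert i j k = S + (S + S).
  rewrite /S -sum_cyc; apply: eq_bigr => i _; apply: eq_bigr => j _; apply: eq_bigr => k _.
  by rewrite /cyc_cert (gC k j) (gC k i) (gC j i).
have sum1 (a : 'I_N) : \sum_b ((a == b)%:R : R) = 1.
  by rewrite (bigD1 a) //= eqxx big1 ?addr0 // => b; rewrite eq_sym => /negbTE ->.
have sumN : \sum_(a < N) (1 : R) = N%:R by rewrite sumr_const card_ord.
have : \sum_i \sum_j \sum_k cyc_cert i j k <=
   - scale R * (3 * N%:R ^+ 2) + 3 * (zonal_cert 1 1 1 + scale R) * N%:R.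
  apply: le_trans (ler_sum _ (fun i _ => ler_sum _ (fun j _ =>
    ler_sum _ (fun k _ => cyc_cert_le i j k)))) _.
  under eq_bigr => i _ do under eq_bigr => j _ do rewrite big_split /= -!mulr_sumr.
  under eq_bigr => i _ do rewrite big_split /= -!mulr_sumr.
  rewrite big_split /= -!mulr_sumr; apply: lerD;
    rewrite le_eqVlt; apply/orP; left; apply/eqP; congr (_ * _).
    (* Each pairwise coincidence occurs in N^2 triples, and below the full coincidence in N. *)
    under eq_bigr => i _ do under eq_bigr => j _ do rewrite !big_split /= !sum1 sumr_const card_ord.
    under eq_bigr => i _ do rewrite !big_split /= sumrMnl sum1 !sumr_const card_ord.
    rewrite !big_split /= !sumr_const card_ord.
    by rewrite -[1 *+ N]/(N%:R) -(mulr_natr N%:R); move: (N%:R) => n; ring.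
  rewrite -sumN; apply: eq_bigr => i _; rewrite (bigD1 i) //= eqxx /= sum1 big1 ?addr0 // => j ji.
  by rewrite big1 // => k _; rewrite eq_sym (negbTE ji).
rewrite S3; move: (zonal_cert_diag R) (scale_gt0 R).
clearbody S; clear S3 sum1 sumN gC.
move: (scale R) (zonal_cert 1 1 1) => s f; clear -S0; move=> fs s0 h.
have [-> //|N0] := posnP N.
rewrite -ltnS -(ltr_nat R) -(ltr_pM2l s0).
have : 0 < N%:R :> R by rewrite ltr0n.
move: N%:R h => n h n0.
have : 0 <= n * (- s * n + (f + s)).
  rewrite -(pmulr_rge0 _ (ltr0Sn _ 2)); apply: le_trans (_ : S + (S + S) <= _); first by lra.
  by apply: le_trans h _; rewrite le_eqVlt; apply/orP; left; apply/eqP; ring.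
rewrite pmulr_rge0 // mulNr => h1.
rewrite (_ : 13%:R = 12 + 1) ?mulrDr ?mulr1; last by rewrite -natr1.
by move: (s * n) h1 => k; lra.
Qed.
End Config.
End Kissing.

(** * Volume in space and its behaviour under affine maps *)

Section Scales.
Context d (T : measurableType d) (R : realType).
Local Open Scope ereal_scope.

(** Phrased with preimages, so for an invertible affine map [k] is the inverse of the absolute
    determinant. *)
Definition scales (mu : set T -> \bar R) (f : T -> T) (k : R) :=
  measurable_fun setT f /\ forall A, measurable A -> mu (f @^-1` A) = k%:E * mu A.

Variable mu : {measure set T -> \bar R}.

Lemma scales_integral f k (phi : T -> \bar R) : (0 <= k)%R -> scales mu f k ->
  measurable_fun setT phi -> (forall x, 0 <= phi x) ->
  \int[mu]_x phi (f x) = k%:E * \int[mu]_x phi x.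
Proof.
move=> k0 [mf fk] mphi phi0.
have -> : \int[mu]_x phi (f x) = \int[pushforward mu f]_x phi x.
  by rewrite ge0_integral_pushforward.
pose kk := NngNum k0.
rewrite -[k%:E]/(kk%:num%:E) -ge0_integral_mscale //.
by apply: eq_measure_integral => A mA _; exact: fk.
Qed.
End Scales.

Section ScalesProd.
Context d1 d2 (T1 : measurableType d1) (T2 : measurableType d2) (R : realType).
Variable m1 : {sigma_finite_measure set T1 -> \bar R}.
Variable m2 : {sigma_finite_measure set T2 -> \bar R}.
Local Open Scope ereal_scope.

(** The section at [x] of the preimage is the [g]-preimage of the section of [A] at [f x]; then
    [scales_integral] changes the variable of the outer integral. *)
Lemma scales_prod f g k l : (0 <= k)%R -> (0 <= l)%R -> scales m1 f k -> scales m2 g l ->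
  scales (m1 \x m2) (fun p => (f p.1, g p.2)) (k * l).
Proof.
move=> k0 l0 sf [mg gl]; have mfg : measurable_fun setT (fun p : T1 * T2 => (f p.1, g p.2)).
  by apply: measurable_fun_pair; apply: measurableT_comp => //; case: sf.
split=> // A mA; rewrite /product_measure1 /=.
under eq_integral => x _.
  have -> : m2 (xsection ((fun p => (f p.1, g p.2)) @^-1` A) x) = l%:E * m2 (xsection A (f x)).
    rewrite -gl; last exact: measurable_xsection.
    by congr (m2 _); apply/seteqP; split=> y; rewrite /xsection /= !inE.
  over.
pose phi := m2 \o xsection A.
have mphi : measurable_fun setT phi by exact: measurable_fun_xsection.
have mphif : measurable_fun setT (phi \o f) by apply: measurableT_comp => //; case: sf.
rewrite -[LHS]/(\int[m1]_x (l%:E * (phi \o f) x)) ge0_integralZl ?lee_fin //.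
rewrite (scales_integral k0 sf mphi) //.
by rewrite muleA -EFinM mulrC.
Qed.
End ScalesProd.

Section Line.
Context (R : realType).
Local Notation RR := (measurableTypeR R).
Local Notation lam := (@lebesgue_measure R).
Local Open Scope ereal_scope.

(** [|a|] times the pushforward agrees with Lebesgue measure on half-open intervals, hence on all
    measurable sets by uniqueness. *)
Lemma scales_affine (a b : R) : a != 0%R ->
  scales lam (fun x : RR => (a * x + b)%R : RR) `|a|^-1.
Proof.
move=> a0.
have mf : measurable_fun setT (fun x : RR => (a * x + b)%R : RR).
  by apply: measurable_funD => //; apply: measurable_funM.
split=> // A mA.
have h0 : (0 <= `|a|)%R by [].
have na : `|a|%R != 0%R by rewrite normr_eq0.
pose f := fun x : RR => (a * x + b)%R : RR.
pose mm : {measure set RR -> \bar R} := mscale (NngNum h0) (pushforward lam f).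
pose m : {measure set RR -> \bar R} := mm mf.
suff -> : lam A = m A by rewrite /m /= /mscale /= muleA -EFinM mulVf // mul1e.
apply: (@lebesgue_measure_unique R m) => // X [[x y] _ <-].
have -> : m [set` `]x, y]] = `|a|%:E * lam (f @^-1` [set` `]x, y]]) by [].
have [ap|an] : (0 < a \/ a < 0)%R by apply/orP; rewrite orbC -neq_lt.
  have -> : f @^-1` [set` `]x, y]] = [set` `]((x - b) / a)%R, ((y - b) / a)%R]].
    by apply/seteqP; split=> z; rewrite /f /= !in_itv /= ltr_pdivrMr // ler_pdivlMr //;
      rewrite ltrBlDr lerBrDr mulrC.
  rewrite !lebesgue_measure_itv /= !lte_fin (gtr0_norm ap).
  rewrite ltr_pM2r ?invr_gt0 // ltrBlDr subrK; case: ifPn => _; last by rewrite mule0.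
  by rewrite -!EFinD -EFinM; congr EFin; field; rewrite gt_eqF.
(* A negative slope reverses the interval, so the closed end changes sides. *)
have -> : f @^-1` [set` `]x, y]] = [set` `[((y - b) / a)%R, ((x - b) / a)%R[].
  by apply/seteqP; split=> z; rewrite /f /= !in_itv /= ltr_ndivlMr // ler_ndivrMr //;
    rewrite ltrBlDr lerBrDr mulrC andbC.
rewrite !lebesgue_measure_itv /= !lte_fin (ltr0_norm an).
rewrite ltr_nM2r ?invr_lt0 // ltrBlDr subrK; case: ifPn => _; last by rewrite mule0.
by rewrite -!EFinD -EFinM; congr EFin; field; rewrite lt_eqF.
Qed.
End Line.

Section Space.
Context (R : realType).
Local Notation RR := (measurableTypeR R).
Local Notation lam := (@lebesgue_measure R).
Local Open Scope ereal_scope.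

Definition area : set (RR * RR)%type -> \bar R := lam \x lam.
HB.instance Definition _ := Measure.on area.

Lemma area_sigma_finite : sigma_finite setT area.
Proof.
have /sigma_finiteP[F [TF ndF Foo]] := sigma_finiteT lam.
exists (fun n => F n `*` F n).
  rewrite -setXTT TF predeqE => -[x y]; split => [[[n _ Fx] [k _ Fy]]|[n _ [Fx Fy]]].
    exists (maxn n k) => //; split.
      by move/subsetPset : (ndF _ _ (leq_maxl n k)); apply.
    by move/subsetPset : (ndF _ _ (leq_maxr n k)); apply.
  by split; exists n.
move=> k; have [mF Fk] := Foo k; split; first exact: measurableX.
by rewrite /area product_measure1E // lte_mul_pinfty // ge0_fin_numE.
Qed.
HB.instance Definition _ := Measure_isSigmaFinite.Build _ _ _ area area_sigma_finite.

Definition volume : set (RR * (RR * RR))%type -> \bar R := lam \x area.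
HB.instance Definition _ := Measure.on volume.

Lemma area_ysection (B : set (RR * RR)) : measurable B ->
  area B = \int[lam]_y (lam \o ysection B) y.
Proof.
move=> mB; rewrite -[RHS]/((lam \x^ lam) B).
apply: product_measure_unique mB => A' B' mA' mB'; exact: product_measure2E.
Qed.

Lemma scales_diag (a b c x y z : R) : a != 0%R -> b != 0%R -> c != 0%R ->
  scales volume (fun p => (a * p.1 + x, (b * p.2.1 + y, c * p.2.2 + z)))%R
    (`|a|^-1 * (`|b|^-1 * `|c|^-1)).
Proof.
move=> a0 b0 c0; have inv0 (u : R) : (0 <= `|u|^-1)%R by rewrite invr_ge0.
apply: (@scales_prod _ _ _ _ _ lam area (fun t : RR => (a * t + x)%R : RR)
  (fun q : RR * RR => ((b * q.1 + y)%R : RR, (c * q.2 + z)%R : RR))); rewrite ?mulr_ge0 //.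
  exact: scales_affine.
exact: scales_prod (inv0 b) (inv0 c) (scales_affine y b0) (scales_affine z c0).
Qed.

Definition rot3 T (p : T * (T * T)) : T * (T * T) := (p.2.1, (p.2.2, p.1)).

Lemma measurable_rot3 : measurable_fun setT (@rot3 RR).
Proof.
apply: measurable_fun_pair; first exact: measurableT_comp.
by apply: measurable_fun_pair => //; exact: measurableT_comp.
Qed.

(** Uniqueness of the product measure leaves products [A] x [B] with [B] planar. Fixing the first
    coordinate x of the preimage leaves [A] times a horizontal section of [B], and [area_ysection]
    integrates these sections. *)
Lemma scales_rot3 : scales volume (@rot3 RR) 1.
Proof.
have mf := measurable_rot3; split=> // X mX; rewrite mul1e.
pose mm : {measure set (RR * (RR * RR)) -> \bar R} := pushforward volume (@rot3 RR).
pose m : {measure set (RR * (RR * RR)) -> \bar R} := mm mf.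
have -> : volume ((@rot3 RR) @^-1` X) = m X by reflexivity.
symmetry.
apply: product_measure_unique => // A B mA mB.
rewrite -[LHS]/(\int[lam]_x area (xsection ((@rot3 RR) @^-1` (A `*` B)) x)).
have mY : measurable_fun setT (lam \o ysection B) by exact: measurable_fun_ysection.
under eq_integral => x _.
  have -> : xsection ((@rot3 RR) @^-1` (A `*` B)) x = A `*` ysection B x.
    by apply/seteqP; split=> -[y z]; rewrite /xsection /ysection /= !inE.
  have -> : area (A `*` ysection B x) = lam A * (lam \o ysection B) x.
    by apply: product_measure1E => //; exact: measurable_ysection.
  over.
rewrite (ge0_integralZl lam measurableT mY (fun x _ => measure_ge0 lam _) (measure_ge0 lam A)).
congr (_ * _).
exact/esym/area_ysection.
Qed.
End Space.

(** * The Brunn-Minkowski inequality *)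

Section LineBM.
Context (R : realType).
Local Notation RR := (measurableTypeR R).
Local Notation lam := (@lebesgue_measure R).

Lemma lam_translate (A : set RR) (c : R) : measurable A ->
  measurable [set z : RR | A (z - c)] /\ lam [set z : RR | A (z - c)] = lam A.
Proof.
move=> mA; have [mf e] := scales_affine (- c) (@oner_neq0 R).
have -> : [set z : RR | A (z - c)] = (fun x : RR => (1 * x - c)%R : RR) @^-1` A.
  by apply/seteqP; split=> z /=; rewrite mul1r.
split; first by rewrite -[X in measurable X]setTI; exact: mf.
by rewrite e // normr1 invr1 mul1e.
Qed.

(* The translates A + y0 and x0 + B, where x0 is close to sup A and y0 to inf B, lie in C and
   overlap in a short interval. *)
Lemma line_brunn_minkowski (A B C : set RR) (L : R) :
  measurable A -> measurable B -> measurable C -> A !=set0 -> B !=set0 ->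
  (forall x, A x -> `|x| <= L) -> (forall x, B x -> `|x| <= L) ->
  (forall x y, A x -> B y -> C (x + y)) -> (lam A + lam B <= lam C)%E.
Proof.
move=> mA mB mC [a0 Aa0] [b0 Bb0] AL BL ABC.
have supA : has_sup A.
  by split; [exists a0 | exists L => x /AL; rewrite ler_norml => /andP[]].
have infB : has_inf B.
  by split; [exists b0 | exists (- L) => x /BL; rewrite ler_norml => /andP[]].
apply/lee_addgt0Pr => e e0; have e2 : 0 < e / 2 by lra.
have [x0 Ax0 x0e] := sup_adherent e2 supA.
have [y0 By0 y0e] := inf_adherent e2 infB.
have [mA1 A1e] := lam_translate y0 mA.
have [mB1 B1e] := lam_translate x0 mB.
set A1 := [set z : RR | A (z - y0)] in mA1 A1e.
set B1 := [set z : RR | B (z - x0)] in mB1 B1e.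
pose I := [set` `[x0 + inf B, sup A + y0]] : set RR.
have mI : measurable I by exact: measurable_itv.
have lI : (lam I <= e%:E)%E.
  rewrite /I lebesgue_measure_itv /=; case: ifPn => _; last by rewrite lee_fin ltW.
  by rewrite -EFinD lee_fin; lra.
have dis : (A1 `\` I) `&` B1 = set0.
  apply/seteqP; split=> z //= -[[Az nI] Bz]; apply: nI; rewrite /I /= in_itv /=.
  have := sup_upper_bound supA Az; have := ge_inf infB.2 Bz; lra.
have sub : (A1 `\` I) `|` B1 `<=` C.
  move=> z [[Az _]|Bz].
    by have := ABC _ _ Az By0; rewrite subrK.
  by have := ABC _ _ Ax0 Bz; rewrite addrC subrK.
have mAI : measurable (A1 `\` I) by exact: measurableD.
have h1 : (lam A1 <= lam (A1 `\` I) + e%:E)%E.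
  apply: (@le_trans _ _ (lam (A1 `\` I) + lam I)%E); last exact: leeD2l.
  apply: (@le_trans _ _ (lam ((A1 `\` I) `|` I))).
    apply: le_measure; rewrite ?inE //; first exact: measurableU.
    by move=> z Az; have [Iz|nIz] := pselect (I z); [right|left].
  exact: measureU2.
have h2 : (lam (A1 `\` I) + lam B1 <= lam C)%E.
  rewrite -measureU //; apply: le_measure; rewrite ?inE //; exact: measurableU.
rewrite -A1e -B1e; apply: le_trans (leeD2r _ h1) _.
by rewrite addeAC; exact: leeD2r.
Qed.
End LineBM.

Section Levels.
Context (R : realType).
Local Notation RR := (measurableTypeR R).
Local Notation lam := (@lebesgue_measure R).

Lemma measurable_lam_xsection (S : set (RR * RR)) : measurable S ->
  measurable_fun setT (lam \o xsection S).
Proof. by move=> mS; exact: measurable_fun_xsection. Qed.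

Lemma measurable_lam_ysection (S : set (RR * RR)) : measurable S ->
  measurable_fun setT (lam \o ysection S).
Proof. by move=> mS; exact: measurable_fun_ysection. Qed.

(** The region under the graph of [phi / c], cut off at height 1. *)
Definition hypograph (phi : RR -> R) (c : R) : set (RR * RR) :=
  [set p | 0 < p.2 < 1 /\ p.2 * c < phi p.1].

Lemma measurable_hypograph phi c : measurable_fun setT (phi : RR -> RR) ->
  measurable (hypograph phi c).
Proof.
move=> mphi.
have m2 : measurable_fun setT (snd : RR * RR -> RR) by [].
have mphi1 : measurable_fun setT (phi \o fst : RR * RR -> RR) by exact: measurableT_comp.
have mb : measurable_fun setT (fun p : RR * RR => (0 < p.2) && (p.2 < 1) && (p.2 * c < phi p.1)).
  apply: measurable_and; first by apply: measurable_and; apply: measurable_fun_ltr.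
  by apply: measurable_fun_ltr => //; apply: measurable_funM.
have -> : hypograph phi c =
    setT `&` (fun p : RR * RR => (0 < p.2) && (p.2 < 1) && (p.2 * c < phi p.1)) @^-1` [set true].
  rewrite setTI; apply/seteqP; split=> p /=; rewrite /hypograph /=; first by case=> -> ->.
  by case/andP=> -> ->.
exact: mb.
Qed.

(** The cut at height 1 can only lose area, which is the direction wanted for the function [h] of
    the sum set. *)
Lemma area_hypograph_le phi c : measurable_fun setT (phi : RR -> RR) -> 0 < c ->
  (forall x, 0 <= phi x) ->
  (area (hypograph phi c) <= \int[lam]_x (phi x / c)%:E)%E.
Proof.
move=> mphi c0 phi0; apply: ge0_le_integral => //.
- exact: (measurable_lam_xsection (measurable_hypograph c mphi)).
- by apply/measurable_EFinP; apply: measurable_funM.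
move=> x _ /=.
apply: (@le_trans _ _ (lam [set` `]0, phi x / c[])).
  apply: le_measure; rewrite ?inE.
  - exact: (measurable_xsection _ (measurable_hypograph c mphi)).
  - exact: measurable_itv.
  move=> t; rewrite /xsection /= inE /hypograph /= in_itv /= ltr_pdivlMr //.
  by case=> /andP[-> _].
rewrite lebesgue_measure_itv /= lte_fin; case: ifPn => _; first by rewrite -EFinD subr0.
by rewrite lee_fin divr_ge0 // ltW.
Qed.

(** Under the bound [c] the cut loses nothing; this is the direction for the two summands. *)
Lemma area_hypograph_ge phi c : measurable_fun setT (phi : RR -> RR) -> 0 < c ->
  (forall x, 0 <= phi x <= c) ->
  (\int[lam]_x (phi x / c)%:E <= area (hypograph phi c))%E.
Proof.
move=> mphi c0 phi0; apply: ge0_le_integral => //.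
- by move=> x _; rewrite lee_fin divr_ge0 ?(ltW c0) //; case/andP: (phi0 x).
- by apply/measurable_EFinP; apply: measurable_funM.
- exact: (measurable_lam_xsection (measurable_hypograph c mphi)).
move=> x _ /=; have /andP[p0 pc] := phi0 x.
apply: (@le_trans _ _ (lam [set` `]0, phi x / c[])).
  rewrite lebesgue_measure_itv /= lte_fin; case: ifPn; first by rewrite -EFinD subr0.
  by rewrite -leNgt lee_fin.
apply: le_measure; rewrite ?inE.
- exact: measurable_itv.
- exact: (measurable_xsection _ (measurable_hypograph c mphi)).
move=> t; rewrite /xsection /= inE /hypograph /= in_itv /= => /andP[t0 tc].
rewrite t0 -ltr_pdivlMr //; split=> //; apply: lt_le_trans tc _.
by rewrite ler_pdivrMr // mul1r.
Qed.

(* The one-dimensional inequality applied to the level sets of the normalized functions. *)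
Lemma level_sets_brunn_minkowski (f g h : RR -> R) (M N K L : R) :
  measurable_fun setT (f : RR -> RR) -> measurable_fun setT (g : RR -> RR) ->
  measurable_fun setT (h : RR -> RR) -> 0 < M -> 0 < N -> 0 < K ->
  (forall x, 0 <= f x <= M) -> (forall x, 0 <= g x <= N) -> (forall x, 0 <= h x) ->
  (forall x, f x != 0 -> `|x| <= L) -> (forall x, g x != 0 -> `|x| <= L) ->
  (forall t, 0 < t < 1 -> exists x, t * M < f x) ->
  (forall t, 0 < t < 1 -> exists x, t * N < g x) ->
  (forall t x y, 0 < t < 1 -> t * M < f x -> t * N < g y -> t * K < h (x + y)) ->
  (\int[lam]_x (f x / M)%:E + \int[lam]_x (g x / N)%:E <= \int[lam]_x (h x / K)%:E)%E.
Proof.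
move=> mf mg mh M0 N0 K0 fM gN h0 fL gL supf supg fgh.
apply: le_trans (area_hypograph_le mh K0 h0).
apply: le_trans (leeD (area_hypograph_ge mf M0 fM) (area_hypograph_ge mg N0 gN)) _.
have mHf := measurable_hypograph M mf; have mHg := measurable_hypograph N mg.
have mHh := measurable_hypograph K mh.
rewrite !area_ysection // -ge0_integralD //;
  try (by apply: measurable_lam_ysection); try (by move=> *; exact: measure_ge0).
apply: ge0_le_integral => //; try (by apply: measurable_lam_ysection).
- by move=> *; apply: adde_ge0.
- by apply: emeasurable_funD; apply: measurable_lam_ysection.
move=> t _ /=; have [t01|nt01] := pselect (0 < t < 1); last first.
  have e0 phi c : ysection (hypograph phi c) t = set0.
    by apply/seteqP; split=> // x; rewrite /ysection /= inE => -[].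
  by rewrite !e0 !measure0 adde0.
have e phi c x : ysection (hypograph phi c) t x <-> t * c < phi x.
  by rewrite /ysection /= inE; split=> [[]//|]; split.
apply: (@line_brunn_minkowski _ _ _ _ L).
- exact: measurable_ysection.
- exact: measurable_ysection.
- exact: measurable_ysection.
- by have [x hx] := supf t t01; exists x; apply/e.
- by have [x hx] := supg t t01; exists x; apply/e.
- move=> x /e hx; apply: fL; rewrite gt_eqF //; apply: le_lt_trans hx.
  by rewrite mulr_ge0 // ltW //; case/andP: t01.
- move=> x /e hx; apply: gL; rewrite gt_eqF //; apply: le_lt_trans hx.
  by rewrite mulr_ge0 // ltW //; case/andP: t01.
by move=> x y /e hx /e hy; apply/e/fgh.
Qed.
End Levels.

(** * Raising the dimension by one: from an inequality for slices to one for the product *)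

Section Slices.
Context (R : realType) d (T : measurableType d) (m : {sigma_finite_measure set T -> \bar R}).
Local Notation RR := (measurableTypeR R).
Local Notation lam := (@lebesgue_measure R).
Variables (add : T -> T -> T) (bd : R -> set T) (G : R -> R -> R).
Hypothesis bd_measurable : forall L, measurable (bd L).
Hypothesis bd_finite : forall L, (m (bd L) < +oo)%E.
Hypothesis inner : forall (A B C : set T) L, measurable A -> measurable B -> measurable C ->
  A `<=` bd L -> B `<=` bd L -> C `<=` bd L -> (0 < m A)%E -> (0 < m B)%E ->
  (forall x y, A x -> B y -> C (add x y)) -> G (fine (m A)) (fine (m B)) <= fine (m C).
Hypothesis G_gt0 : forall a b, 0 < a -> 0 < b -> 0 < G a b.
Hypothesis G_scale : forall t M N a b, 0 < t -> 0 < M -> 0 < N ->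
  t * M < a -> t * N < b -> t * G M N < G a b.

Local Notation vol := (product_measure1 lam m).

Definition box (L : R) : set (RR * T) := [set p | `|p.1| <= L /\ bd L p.2].

Lemma boxE L : box L = [set` `[- L, L]] `*` bd L.
Proof.
by apply/seteqP; split=> p; rewrite /box /= in_itv /= ler_norml.
Qed.

Lemma measurable_box L : measurable (box L).
Proof. by rewrite boxE; apply: measurableX => //; exact: measurable_itv. Qed.

Lemma box_finite L : (vol (box L) < +oo)%E.
Proof.
have mI : measurable ([set` `[- L, L]] : set RR) by exact: measurable_itv.
have fI : lam [set` `[- L, L]] \is a fin_num.
  by rewrite lebesgue_measure_itv /=; case: ifPn.
by rewrite boxE product_measure1E // lte_mul_pinfty // measure_ge0.
Qed.

Section OneSet.
Variables (A : set (RR * T)) (L : R).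
Hypotheses (mA : measurable A) (AL : A `<=` box L).
Let f (x : RR) : RR := fine (m (xsection A x)).

Lemma slice_fin x : m (xsection A x) \is a fin_num.
Proof.
rewrite ge0_fin_numE ?measure_ge0 //; apply: le_lt_trans (bd_finite L).
apply: le_measure; rewrite ?inE //; first exact: measurable_xsection.
by move=> y; rewrite /xsection /= inE => /AL [].
Qed.

Lemma sliceE x : (f x)%:E = m (xsection A x).
Proof. by rewrite /f fineK ?slice_fin. Qed.

Lemma measurable_slice : measurable_fun setT f.
Proof.
apply/measurable_EFinP; have -> : EFin \o f = m \o xsection A.
  by apply/funext => x; rewrite /= sliceE.
exact: measurable_fun_xsection.
Qed.

Lemma slice_ge0 x : 0 <= f x.
Proof. by rewrite /f fine_ge0 ?measure_ge0. Qed.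

Lemma integral_slice M : 0 < M ->
  (\int[lam]_x (f x / M)%:E = M^-1%:E * vol A)%E.
Proof.
move=> M0; rewrite /product_measure1 -ge0_integralZl //; first last.
- by rewrite lee_fin invr_ge0 ltW.
- exact: measurable_fun_xsection.
by apply: eq_integral => x _; rewrite /= -sliceE -EFinM mulrC.
Qed.

Lemma product_fin : vol A \is a fin_num.
Proof.
rewrite ge0_fin_numE ?measure_ge0 //; apply: le_lt_trans (box_finite L).
by apply: le_measure; rewrite ?inE //; exact: measurable_box.
Qed.

Lemma slice_sup : (0 < vol A)%E -> exists M, [/\ 0 < M, forall x, 0 <= f x <= M &
  forall t, 0 < t < 1 -> exists x, t * M < f x].
Proof.
move=> A0; pose E := range f; pose K := fine (m (bd L)).
have fK x : f x <= K.
  rewrite -lee_fin sliceE fineK; last by rewrite ge0_fin_numE ?measure_ge0.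
  apply: le_measure; rewrite ?inE //; first exact: measurable_xsection.
  by move=> y; rewrite /xsection /= inE => /AL [].
have supE : has_sup E.
  by split; [exists (f 0), 0 | exists K => _ [x _ <-]].
have fM x : f x <= sup E by apply: (sup_upper_bound supE); exists x.
(* Were all slices null, their integral, the volume of [A], would vanish. *)
have M0 : 0 < sup E.
  rewrite ltNge; apply/negP => M0; move: A0.
  rewrite -[X in (_ < X)%E]/(\int[lam]_x m (xsection A x))%E.
  rewrite integral0_eq ?ltxx // => x _; rewrite -sliceE; congr EFin.
  by apply/eqP; rewrite eq_le slice_ge0 andbT; apply: le_trans M0.
exists (sup E); split=> // [x|t /andP[t0 t1]]; first by rewrite slice_ge0 fM.
have e0 : 0 < (1 - t) * sup E by rewrite mulr_gt0 // subr_gt0.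
have [_ [x _ <-] hx] := sup_adherent e0 supE.
by exists x; apply: le_lt_trans hx; lra.
Qed.

Lemma slice_supp x : f x != 0 -> `|x| <= L.
Proof.
move=> fx; rewrite leNgt; apply/negP => Lx; move: fx; rewrite /f.
have -> : xsection A x = set0; last by rewrite measure0 eqxx.
apply/seteqP; split=> // y; rewrite /xsection /= inE => /AL [/= h _].
by move: Lx; rewrite ltNge h.
Qed.
End OneSet.

(** [M] and [N] are the suprema of the slice measures. Slices of [A] and [B] larger than t M and t N
    add up into a slice of [C] larger than t [G M N], by [inner] and [G_scale]; so the level set
    inequality applies with normalizations [M], [N], [G M N]. *)
Lemma slices_brunn_minkowski (A B C : set (RR * T)) L :
  measurable A -> measurable B -> measurable C ->
  A `<=` box L -> B `<=` box L -> C `<=` box L ->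
  (0 < vol A)%E -> (0 < vol B)%E ->
  (forall p q, A p -> B q -> C (p.1 + q.1, add p.2 q.2)) ->
  exists M N, [/\ 0 < M, 0 < N & G M N * (fine (vol A) / M + fine (vol B) / N)
    <= fine (vol C)].
Proof.
move=> mA mB mC AL BL CL A0 B0 ABC.
have [M [M0 fM supf]] := slice_sup mA AL A0.
have [N [N0 gN supg]] := slice_sup mB BL B0.
exists M, N; split=> //; have K0 := G_gt0 M0 N0.
have := level_sets_brunn_minkowski (measurable_slice mA AL)
  (measurable_slice mB BL) (measurable_slice mC CL)
  M0 N0 K0 fM gN (slice_ge0 C) (slice_supp AL) (slice_supp BL) supf supg.
rewrite !(integral_slice mA AL, integral_slice mB BL, integral_slice mC CL) //.
have fA := product_fin mA AL; have fB := product_fin mB BL; have fC := product_fin mC CL.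
rewrite -(fineK fA) -(fineK fB) -(fineK fC) -!EFinM -EFinD lee_fin /=.
set a := fine _; set b := fine _; set c := fine _ => h.
rewrite -ler_pdivlMl // [a / M]mulrC [b / N]mulrC; apply: h => t x y t01 ha hb.
have t0 : 0 < t by case/andP: t01.
apply: lt_le_trans (G_scale t0 M0 N0 ha hb) _.
have pos (S : set (RR * T)) (z : R) k : measurable S -> S `<=` box L -> 0 < k ->
    t * k < fine (m (xsection S z)) -> (0 < m (xsection S z))%E.
  move=> mS SL k0 hk; rewrite -(sliceE mS SL) lte_fin; apply: le_lt_trans hk.
  by rewrite mulr_ge0 // ltW.
apply: (@inner _ _ _ L); try exact: measurable_xsection.
- by move=> z; rewrite /xsection /= inE => /AL [].
- by move=> z; rewrite /xsection /= inE => /BL [].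
- by move=> z; rewrite /xsection /= inE => /CL [].
- exact: pos ha.
- exact: pos hb.
by move=> u v; rewrite /xsection /= !inE => hu hv; exact: (ABC _ _ hu hv).
Qed.
End Slices.

Section BrunnMinkowski.
Context (R : realType).
Local Notation RR := (measurableTypeR R).
Local Notation lam := (@lebesgue_measure R).
Local Notation sq := Num.sqrt.

Definition cube1 (L : R) : set RR := [set` `[- L, L]].
Definition plane_mean (a b : R) := (sq a + sq b) ^+ 2.

(** Cauchy-Schwarz with its defect as an explicit square; it eliminates the suprema [M], [N] left by
    slicing the plane. *)
Lemma cauchy_slices (M N a b : R) : 0 < M -> 0 < N -> 0 <= a -> 0 <= b ->
  plane_mean a b <= (M + N) * (a / M + b / N).
Proof.
move=> M0 N0 a0 b0; rewrite -subr_ge0.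
have -> : (M + N) * (a / M + b / N) - plane_mean a b = (N * sq a - M * sq b) ^+ 2 / (M * N).
  rewrite /plane_mean -{1}(sqr_sqrtr a0) -{1}(sqr_sqrtr b0); field.
  by rewrite !gt_eqF.
by rewrite divr_ge0 ?sqr_ge0 ?mulr_ge0 ?ltW.
Qed.

(** The counterpart for space: with u^2 = M and v^2 = N it is Hölder's inequality (a + b)^3 <= (u +
    v)^2 (a^3 / u^2 + b^3 / v^2). *)
Lemma hoelder_slices (M N a b : R) : 0 < M -> 0 < N -> 0 < a -> 0 < b ->
  (a + b) ^+ 3 <= plane_mean M N * (a ^+ 3 / M + b ^+ 3 / N).
Proof.
move=> M0 N0 a0 b0; rewrite -{2}(sqr_sqrtr (ltW M0)) -{2}(sqr_sqrtr (ltW N0)) /plane_mean.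
have : 0 < sq M by rewrite sqrtr_gt0.
have : 0 < sq N by rewrite sqrtr_gt0.
move: (sq M) (sq N) => u v v0 u0.
pose s := a + b; pose l := u / (u + v); pose k := v / (u + v).
have uv0 : 0 < u + v by rewrite addr_gt0.
have s0 : 0 < s by rewrite addr_gt0.
have l0 : 0 < l by rewrite divr_gt0.
have k0 : 0 < k by rewrite divr_gt0.
have lk : l + k = 1 by rewrite /l /k; field; rewrite gt_eqF.
(* Tangent plane of the convex function x^3 / y^2 along x = s y. *)
have tangent (x y : R) : 0 < x -> 0 < y -> 3 * x * s ^+ 2 - 2 * y * s ^+ 3 <= x ^+ 3 / y ^+ 2.
  move=> x0 y0; rewrite ler_pdivlMr ?exprn_gt0 // -subr_ge0.
  have -> : x ^+ 3 - (3 * x * s ^+ 2 - 2 * y * s ^+ 3) * y ^+ 2 =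
      (x - y * s) ^+ 2 * (x + 2 * (y * s)).
    by ring.
  by rewrite mulr_ge0 ?sqr_ge0 // addr_ge0 ?mulr_ge0 // ltW.
have -> : (u + v) ^+ 2 * (a ^+ 3 / u ^+ 2 + b ^+ 3 / v ^+ 2) = a ^+ 3 / l ^+ 2 + b ^+ 3 / k ^+ 2.
  by rewrite /l /k; field; rewrite !gt_eqF.
apply: le_trans (lerD (tangent _ _ a0 l0) (tangent _ _ b0 k0)).
have -> : 3 * a * s ^+ 2 - 2 * l * s ^+ 3 + (3 * b * s ^+ 2 - 2 * k * s ^+ 3)
  = 3 * (a + b) * s ^+ 2 - 2 * (l + k) * s ^+ 3 by ring.
by rewrite lk -/s le_eqVlt; apply/orP; left; apply/eqP; ring.
Qed.

Lemma cube1_measurable L : measurable (cube1 L).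
Proof. exact: measurable_itv. Qed.

Lemma cube1_finite L : (lam (cube1 L) < +oo)%E.
Proof. by rewrite lebesgue_measure_itv /=; case: ifPn => _; rewrite -?EFinD ltry. Qed.

Lemma measure_gt0_nonempty d (T : measurableType d) (m : {measure set T -> \bar R}) A :
  (0 < m A)%E -> A !=set0.
Proof. by move=> h; apply/set0P/eqP => A0; move: h; rewrite A0 measure0 ltxx. Qed.

Lemma fine_line_brunn_minkowski (A B C : set RR) L : measurable A -> measurable B -> measurable C ->
  A `<=` cube1 L -> B `<=` cube1 L -> C `<=` cube1 L -> (0 < lam A)%E -> (0 < lam B)%E ->
  (forall x y, A x -> B y -> C (x + y)) -> fine (lam A) + fine (lam B) <= fine (lam C).
Proof.
move=> mA mB mC AL BL CL A0 B0 ABC.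
have fin S : measurable S -> S `<=` cube1 L -> lam S \is a fin_num.
  move=> mS SL; rewrite ge0_fin_numE ?measure_ge0 //; apply: le_lt_trans (cube1_finite L).
  by apply: le_measure; rewrite ?inE //; exact: cube1_measurable.
have bnd S x : S `<=` cube1 L -> S x -> `|x| <= L.
  by move=> SL /SL; rewrite /cube1 /= in_itv /= ler_norml.
rewrite -lee_fin EFinD !fineK ?fin //.
by apply: (@line_brunn_minkowski _ _ _ _ L) => // [||x|x];
  [exact: measure_gt0_nonempty A0|exact: measure_gt0_nonempty B0|exact: bnd|exact: bnd].
Qed.

Definition cube2 : R -> set (RR * RR) := box cube1.
Definition cube3 : R -> set (RR * (RR * RR)) := box cube2.

Lemma area_brunn_minkowski (A B C : set (RR * RR)) L :
  measurable A -> measurable B -> measurable C ->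
  A `<=` cube2 L -> B `<=` cube2 L -> C `<=` cube2 L -> (0 < area A)%E -> (0 < area B)%E ->
  (forall p q, A p -> B q -> C (p + q)) ->
  plane_mean (fine (area A)) (fine (area B)) <= fine (area C).
Proof.
move=> mA mB mC AL BL CL A0 B0 ABC.
have scale (t M N a b : R) : 0 < t -> 0 < M -> 0 < N -> t * M < a -> t * N < b ->
    t * (M + N) < a + b by move=> *; rewrite mulrDr ltrD.
have [M [N [M0 N0]]] := slices_brunn_minkowski cube1_measurable cube1_finite
  fine_line_brunn_minkowski
  (@addr_gt0 R) scale mA mB mC AL BL CL A0 B0 ABC.
by apply: le_trans; apply: cauchy_slices; rewrite ?fine_ge0 ?measure_ge0.
Qed.

Lemma cube2_measurable L : measurable (cube2 L).
Proof. exact: (measurable_box cube1_measurable). Qed.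

Lemma cube2_finite L : (area (cube2 L) < +oo)%E.
Proof. exact: box_finite cube1_measurable cube1_finite L. Qed.

Lemma cube3_measurable L : measurable (cube3 L).
Proof. exact: (measurable_box cube2_measurable). Qed.

Lemma cube3_finite L : (volume (cube3 L) < +oo)%E.
Proof. exact: (@box_finite R _ _ (@area R) _ cube2_measurable cube2_finite L). Qed.

Lemma volume_brunn_minkowski (A B C : set (RR * (RR * RR))) L a b :
  measurable A -> measurable B -> measurable C ->
  A `<=` cube3 L -> B `<=` cube3 L -> C `<=` cube3 L -> 0 < a -> 0 < b ->
  volume A = (a ^+ 3)%:E -> volume B = (b ^+ 3)%:E ->
  (forall p q, A p -> B q -> C (p + q)) -> (a + b) ^+ 3 <= fine (volume C).
Proof.
move=> mA mB mC AL BL CL a0 b0 Aa Bb ABC.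
have pos (u v : R) : 0 < u -> 0 < v -> 0 < plane_mean u v.
  by move=> u0 v0; rewrite /plane_mean exprn_gt0 // addr_gt0 // sqrtr_gt0.
have scale (t M N u v : R) : 0 < t -> 0 < M -> 0 < N -> t * M < u -> t * N < v ->
    t * plane_mean M N < plane_mean u v.
  move=> t0 M0 N0 hu hv; have [tM tN] : 0 < t * M /\ 0 < t * N by rewrite !mulr_gt0.
  have -> : t * plane_mean M N = (sq (t * M) + sq (t * N)) ^+ 2.
    rewrite !sqrtrM ?(ltW t0) // -mulrDr exprMn sqr_sqrtr ?ltW //.
  rewrite /plane_mean ltr_pXn2r ?nnegrE ?addr_ge0 ?sqrtr_ge0 // ltrD // ltr_sqrt //;
    exact: lt_trans hu || exact: lt_trans hv.
have A0 : (0 < volume A)%E by rewrite Aa lte_fin exprn_gt0.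
have B0 : (0 < volume B)%E by rewrite Bb lte_fin exprn_gt0.
have [M [N [M0 N0]]] : exists M N, [/\ 0 < M, 0 < N &
    plane_mean M N * (fine (volume A) / M + fine (volume B) / N) <= fine (volume C)].
  exact: (@slices_brunn_minkowski R _ _ (@area R) _ _ _ cube2_measurable cube2_finite
    area_brunn_minkowski pos scale A B C L mA mB mC AL BL CL A0 B0 ABC).
rewrite Aa Bb; apply: le_trans; exact: hoelder_slices.
Qed.
End BrunnMinkowski.

(** * Exposed directions *)

Section Geometry.
Variable R : rcfType.
Local Notation vec := (R * (R * R))%type.
Implicit Types p q v w : vec.

Definition nsq p : R := dot p p.
Definition norm p : R := Num.sqrt (nsq p).

Lemma nsq_ge0 p : 0 <= nsq p.
Proof. by rewrite /nsq /dot; rewrite !addr_ge0 // -expr2 sqr_ge0. Qed.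

Lemma norm_ge0 p : 0 <= norm p. Proof. exact: sqrtr_ge0. Qed.

Lemma norm_sqr p : norm p ^+ 2 = nsq p.
Proof. by rewrite sqr_sqrtr ?nsq_ge0. Qed.

Lemma norm_gt0 p : (0 < norm p) = (0 < nsq p).
Proof. by rewrite sqrtr_gt0. Qed.

Lemma nsqB p q : nsq (p - q) = nsq p - 2 * dot p q + nsq q.
Proof. by rewrite /nsq /dot /=; ring. Qed.

Lemma nsqD p q : nsq (p + q) = nsq p + 2 * dot p q + nsq q.
Proof. by rewrite /nsq /dot /=; ring. Qed.

(** Lagrange's identity: the difference of the squares is a sum of three squares. *)
Lemma cauchy_schwarz p q : dot p q <= norm p * norm q.
Proof.
apply: le_trans (ler_norm _) _.
rewrite -(ler_pXn2r (ltn0Sn 1)) ?nnegrE ?mulr_ge0 ?norm_ge0 // real_normK ?num_real //.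
rewrite exprMn !norm_sqr -subr_ge0 /nsq /dot.
set a := p.1; set b := p.2.1; set c := p.2.2; set x := q.1; set y := q.2.1; set z := q.2.2.
rewrite [leRHS](_ : _ = (a * y - b * x) ^+ 2 + ((b * z - c * y) ^+ 2 + (a * z - c * x) ^+ 2)).
  by rewrite !addr_ge0 ?sqr_ge0.
by ring.
Qed.

Lemma nsqD_lt p q r s : 0 <= r -> 0 <= s -> nsq p < r ^+ 2 -> nsq q < s ^+ 2 ->
  nsq (p + q) < (r + s) ^+ 2.
Proof.
move=> r0 s0 hp hq.
have np : norm p < r by rewrite -(ltr_pXn2r (ltn0Sn 1)) ?nnegrE ?norm_ge0 // norm_sqr.
have nq : norm q < s by rewrite -(ltr_pXn2r (ltn0Sn 1)) ?nnegrE ?norm_ge0 // norm_sqr.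
have := cauchy_schwarz p q; have := norm_ge0 p; have := norm_ge0 q.
rewrite nsqD -!norm_sqr; move: (norm p) (norm q) (dot p q) np nq => u v d *.
apply: (@le_lt_trans _ _ ((u + v) ^+ 2)); first by rewrite sqrrD mulr2n; lra.
by rewrite ltr_pXn2r ?nnegrE //; lra.
Qed.

Lemma kissing_card (I : finType) (P : {pred I}) (x : I -> vec) :
  (forall i, P i -> 0 < nsq (x i)) ->
  (forall i j, P i -> P j -> i != j -> dot (x i) (x j) <= norm (x i) * norm (x j) / 2) ->
  (#|P| <= 12)%N.
Proof.
move=> x0 sep.
pose u (k : 'I_#|P|) : vec := let v := x (enum_val k) in
  ((norm v)^-1 * v.1, ((norm v)^-1 * v.2.1, (norm v)^-1 * v.2.2)).
have dotu k l : dot (u k) (u l) =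
    dot (x (enum_val k)) (x (enum_val l)) / (norm (x (enum_val k)) * norm (x (enum_val l))).
  by rewrite invfM /dot /=; ring.
have pos (k : 'I_#|P|) : 0 < norm (x (enum_val k)).
  by rewrite norm_gt0 x0 ?enum_valP //; exact: (enum_valP k).
apply: (@kissing_le R #|P| u) => [k|k l kl].
  by rewrite dotu -[dot _ _]norm_sqr expr2 divff // mulf_neq0 // gt_eqF.
rewrite dotu ler_pdivrMr ?mulr_gt0 // mulrC; apply: sep; try exact: (enum_valP _).
by apply: contra kl => /eqP /enum_val_inj ->.
Qed.

(** The expression in absolute value is the inner product of [v] with either of its nontrivial
    rotations; the bound makes all of [orbit6] pairwise at least 60 degrees apart. *)
Definition good v := `|v.1 * v.2.1 + v.2.1 * v.2.2 + v.2.2 * v.1| <= nsq v / 2.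

Definition sgnv (b : bool * bool * bool) v : vec :=
  ((-1) ^+ b.1.1 * v.1, ((-1) ^+ b.1.2 * v.2.1, (-1) ^+ b.2 * v.2.2)).

Lemma dot_sgnv b v w : dot (sgnv b v) (sgnv b w) = dot v w.
Proof.
have s (a : bool) : (-1) ^+ a * (-1) ^+ a = 1 :> R by rewrite -signr_addb addbb.
rewrite /dot /sgnv /=; case: b => -[b1 b2] b3 /=.
by have := s b1; have := s b2; have := s b3;
   move: ((-1) ^+ b1 : R) ((-1) ^+ b2 : R) ((-1) ^+ b3 : R) => x y z; rewrite -!expr2 => hz hy hx;
   ring: hx hy hz.
Qed.

Definition orbit6 (k : bool * 'I_3) v : vec :=
  let w := iter k.2 (@rot3 R) v in if k.1 then - w else w.

Lemma orbit6_nsq k v : nsq (orbit6 k v) = nsq v.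
Proof.
case: k => b j; rewrite /orbit6 /=.
have -> (w : vec) : nsq (if b then - w else w) = nsq w by case: b => //; rewrite /nsq /dot /=; ring.
by case: j => -[|[|[|//]]] ? /=; rewrite /nsq /dot /=; ring.
Qed.

Lemma orbit6_sep k l v : good v -> k != l -> dot (orbit6 k v) (orbit6 l v) <= nsq v / 2.
Proof.
rewrite /good ler_norml; case: v => x [y z]; have := nsq_ge0 (x, (y, z)).
rewrite /orbit6 /nsq /dot /= => n0 /andP[h1 h2].
case: k => -[] [[|[|[|//]]] kp]; case: l => -[] [[|[|[|//]]] lp] //=;
  by rewrite ?eqxx // => _; lra.
Qed.

(** Representatives of the sign changes modulo the global sign, which [orbit6] includes. *)
Definition flips : seq (bool * bool * bool) :=
  [:: (false, false, false); (true, false, false); (false, true, false); (false, false, true)].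

(** Doubled, the two bounds say (a - b + c)^2 >= 0 and (a - c)^2 + b^2 + 2 b (a + c) >= 0. *)
Lemma middle_bound (a b c : R) : 0 <= a -> 0 <= b -> 0 <= c -> 0 <= (a - b) * (b - c) ->
  - (a ^+ 2 + b ^+ 2 + c ^+ 2) / 2 <= a * c - a * b - b * c <= (a ^+ 2 + b ^+ 2 + c ^+ 2) / 2.
Proof.
move=> a0 b0 c0 h; have ac := mulr_ge0 a0 c0; have ab := mulr_ge0 a0 b0; have bc := mulr_ge0 b0 c0.
have := sqr_ge0 (a - c); have := sqr_ge0 (a - b); have := sqr_ge0 (b - c).
rewrite !sqrrB => h1 h2 h3; apply/andP; split; last by nra.
have [hab|hba] := lerP a b; last by nra.
by have [hcb|hbc] := lerP c b; nra.
Qed.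

(* The point is good once the coordinate of middle absolute value has the sign opposite to the
   two others. *)
Lemma good_flip v : exists2 b, b \in flips & good (sgnv b v).
Proof.
case: v => x [y z].
have sgn (w : R) : exists a, 0 <= a /\ (w = a \/ w = - a).
  by exists `|w|; split=> //; have [|] := ger0P w; [left|right; rewrite opprK].
have [a [a0 xa]] := sgn x; have [b [b0 yb]] := sgn y; have [c [c0 zc]] := sgn z.
have mid : [\/ 0 <= (a - b) * (b - c), 0 <= (b - c) * (c - a) | 0 <= (c - a) * (a - b)].
  have [ab|ab] := lerP a b; have [bc|bc] := lerP b c; have [ca|ca] := lerP c a;
    by [apply: Or31; nra | apply: Or32; nra | apply: Or33; nra].
have bound : [\/
   - (a ^+ 2 + b ^+ 2 + c ^+ 2) / 2 <= a * c - a * b - b * c <= (a ^+ 2 + b ^+ 2 + c ^+ 2) / 2,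
   - (a ^+ 2 + b ^+ 2 + c ^+ 2) / 2 <= a * b - b * c - a * c <= (a ^+ 2 + b ^+ 2 + c ^+ 2) / 2 |
   - (a ^+ 2 + b ^+ 2 + c ^+ 2) / 2 <= b * c - a * c - a * b <= (a ^+ 2 + b ^+ 2 + c ^+ 2) / 2].
  case: mid => m; [apply: Or31|apply: Or32|apply: Or33].
  - exact: middle_bound.
  - by have := middle_bound b0 c0 a0 m; lra.
  - by have := middle_bound c0 a0 b0 m; lra.
rewrite /good /nsq /dot /sgnv.
case: bound => bnd; case: xa => ->; case: yb => ->; case: zc => ->;
  first [ by exists (false, false, false); rewrite // /= ?expr0 ?expr1 ler_norml; lra
        | by exists (true, false, false); rewrite // /= ?expr0 ?expr1 ler_norml; lra
        | by exists (false, true, false); rewrite // /= ?expr0 ?expr1 ler_norml; lra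
        | by exists (false, false, true); rewrite // /= ?expr0 ?expr1 ler_norml; lra ].
Qed.
End Geometry.

(** * Counting the exposed points of an orbit *)

Section Orbits.
Variable R : rcfType.
Local Notation vec := (R * (R * R))%type.

Definition orbit24_count (e : vec -> bool) (y : vec) : nat :=
  (\sum_(b : bool * bool * bool) \sum_(j < 3) e (sgnv b (iter j (@rot3 R) y)))%N.

Definition addb3 (a b : bool * bool * bool) := (a.1.1 (+) b.1.1, a.1.2 (+) b.1.2, a.2 (+) b.2).
Definition rotb (s : bool * bool * bool) := (s.1.2, s.2, s.1.1).

Lemma addb3K b : involutive (addb3^~ b).
Proof. by case=> -[x y] z; rewrite /addb3 /= -!addbA !addbb !addbF. Qed.

Lemma sgnv_add a b (v : vec) : sgnv a (sgnv b v) = sgnv (addb3 a b) v.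
Proof. by rewrite /sgnv /= !signr_addb !mulrA. Qed.

Lemma iter_rot_sgnv j s (v : vec) : iter j (@rot3 R) (sgnv s v) =
  sgnv (iter j rotb s) (iter j (@rot3 R) v).
Proof. by elim: j => //= j ->. Qed.

(** Rotations normalize the group of sign changes, so a flip of [y] only permutes its orbit. *)
Lemma orbit24_count_sgnv e s y : orbit24_count e (sgnv s y) = orbit24_count e y.
Proof.
rewrite /orbit24_count exchange_big [RHS]exchange_big /=; apply: eq_bigr => j _.
rewrite (reindex_inj (inv_inj (addb3K (iter j rotb s)))) /=; apply: eq_bigr => b _.
by rewrite iter_rot_sgnv sgnv_add addb3K.
Qed.

Lemma big_bool3 (F : bool * bool * bool -> nat) :
  (\sum_b F b = \sum_(b <- flips) (F b + F (addb3 b (true, true, true))))%N.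
Proof.
have -> : (\sum_b F b = \sum_x \sum_y \sum_z F (x, y, z))%N.
  by rewrite pair_bigA pair_bigA /=; apply: eq_bigr => -[[x y] z].
by rewrite !big_bool !big_cons big_nil /addb3 /=; lia.
Qed.

Lemma orbit24_count_orbit6 e y :
  orbit24_count e y = (\sum_(b <- flips) \sum_(k : bool * 'I_3) e (sgnv b (orbit6 k y)))%N.
Proof.
rewrite /orbit24_count big_bool3; apply: eq_bigr => b _.
have -> : (\sum_(k : bool * 'I_3) e (sgnv b (orbit6 k y)) =
    \sum_(s : bool) \sum_(j < 3) e (sgnv b (orbit6 (s, j) y)))%N.
  by rewrite pair_bigA /=; apply: eq_bigr => -[].
rewrite big_bool addnC; congr (_ + _)%N; apply: eq_bigr => j _; congr (e _ : nat).
rewrite /orbit6 -sgnv_add /=; congr (sgnv b _).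
by rewrite /sgnv /= !expr1 !mulN1r; case: (iter j _ y) => u [v w].
Qed.

Variables (n : nat) (c : 'I_n -> vec).
Hypothesis sep : forall i j, i != j -> 4 <= nsq (c i - c j).

Definition touch i j := nsq (c j - c i) == 4.
Definition deg i := #|[pred j | touch i j]|.
(** Contact directions have length 2, so the bound [norm y] encodes an angle of at least 60
    degrees. *)
Definition exposed i (y : vec) : bool :=
  (0 < nsq y) && [forall j, touch i j ==> (dot y (c j - c i) <= norm y)].

(** Contact directions and exposed points together form a kissing configuration: two contacts are
    separated by the packing, mixed pairs by exposure, the [x k] by assumption. *)
Lemma kissing_exposed i (K : finType) (x : K -> vec) :
  (forall k l, k != l -> dot (x k) (x l) <= norm (x k) * norm (x l) / 2) ->
  (deg i + \sum_k exposed i (x k) <= 12)%N.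
Proof.
move=> xsep.
pose P (t : 'I_n + K) := match t with inl j => touch i j | inr k => exposed i (x k) end.
pose u (t : 'I_n + K) := match t with inl j => c j - c i | inr k => x k end.
have <- : #|P| = (deg i + \sum_k exposed i (x k))%N.
  rewrite -sum1_card big_sumType /= /deg -sum1_card; congr (_ + _)%N.
  by rewrite big_mkcond /=; apply: eq_bigr => k _; rewrite unfold_in /=; case: exposed.
have n2 j : touch i j -> norm (c j - c i) = 2.
  by rewrite /touch /norm => /eqP ->; rewrite (_ : 4 = 2 ^+ 2) ?sqrtr_sqr ?ger0_norm //; ring.
have cross j k : touch i j -> exposed i (x k) ->
    dot (x k) (c j - c i) <= norm (c j - c i) * norm (x k) / 2.
  move=> tj /andP[_ /forallP /(_ j)]; rewrite tj /= n2 // => h; lra.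
apply: (@kissing_card _ _ P u) => [[j|k]|[j|k] [l|m]]; rewrite /P /u.
- by rewrite /touch => /eqP ->.
- by case/andP.
- move=> tj tl jl; rewrite !n2 //.
  have jl' : j != l by apply: contra jl => /eqP ->.
  have := sep jl'; have -> : c j - c l = (c j - c i) - (c l - c i) by rewrite opprB addrA subrK.
  by move: tj tl; rewrite nsqB /touch => /eqP -> /eqP ->; lra.
- by move=> tj ek _; rewrite dotC; exact: cross.
- by move=> ek tl _; rewrite [norm (x k) * _]mulrC; exact: cross.
- by move=> _ _ kl; apply: xsep; apply: contra kl => /eqP ->.
Qed.

(** A flip makes [y] good without changing the count. Sign changes are isometries, so all four
    classes are then separated and [kissing_exposed] applies to each. *)
Lemma orbit24_count_exposed i y : (4 * deg i + orbit24_count (exposed i) y <= 48)%N.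
Proof.
have [b0 _ gy] := good_flip y; rewrite -(orbit24_count_sgnv _ b0) orbit24_count_orbit6.
move: (sgnv b0 y) gy => {}y gy.
have h b : (deg i + \sum_(k : bool * 'I_3) exposed i (sgnv b (orbit6 k y)) <= 12)%N.
  apply: kissing_exposed => k l kl; rewrite dot_sgnv.
  have nE k' : norm (sgnv b (orbit6 k' y)) = norm y.
    by rewrite /norm /nsq dot_sgnv -/(nsq _) orbit6_nsq.
  by rewrite !nE -expr2 norm_sqr; exact: orbit6_sep.
rewrite /flips !big_cons big_nil.
have := h (false, false, false); have := h (true, false, false); have := h (false, true, false).
have := h (false, false, true); lia.
Qed.

Lemma deg_le i : (deg i <= 12)%N.
Proof. have := orbit24_count_exposed i 0; lia. Qed.
End Orbits.

(** Integrates the pointwise bound on the sum of the indicator functions. *)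
Lemma multiplicity_le d (T : measurableType d) (R : realType) (m : {measure set T -> \bar R})
    (I : finType) (F : I -> set T) (S : set T) (k : nat) :
  (forall i, measurable (F i)) -> measurable S -> (forall i, F i `<=` S) ->
  (forall x, S x -> (\sum_i `[< F i x >] <= k)%N) ->
  (\sum_i m (F i) <= k%:R%:E * m S)%E.
Proof.
move=> mF mS FS Fk.
have -> : (\sum_i m (F i) = \int[m]_x (\sum_i (\1_(F i) x)%:E))%E.
  rewrite ge0_integral_sum //; first by apply: eq_bigr => i _; rewrite integral_indic // setIT.
  by move=> i; apply/measurable_EFinP; exact: measurable_indic.
have -> : (k%:R%:E * m S = \int[m]_x (k%:R%:E * (\1_S x)%:E))%E.
  rewrite ge0_integralZl ?lee_fin ?integral_indic ?setIT //.
  by apply/measurable_EFinP; exact: measurable_indic.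
apply: ge0_le_integral => //.
- by move=> x _; apply: sume_ge0.
- by apply: emeasurable_sum => i; apply/measurable_EFinP; exact: measurable_indic.
- by apply/measurable_EFinP; apply: measurable_funM => //; exact: measurable_indic.
move=> x _; rewrite sumEFin -EFinM lee_fin.
have -> : \sum_i (\1_(F i) x : R) = (\sum_i `[< F i x >])%N%:R.
  by rewrite natr_sum; apply: eq_bigr => i _; rewrite indicE;
    congr (nat_of_bool _)%:R; apply/asboolP/asboolP; rewrite inE.
rewrite indicE; have [Sx|nSx] := boolP (x \in S).
  by rewrite mulr1 ler_nat; apply: Fk; rewrite inE in Sx.
rewrite mulr0 big1 // => i _; case: asboolP => // /FS Sx.
by move: nSx; rewrite notin_setE.
Qed.

(** * Volume of the exposed parts and growth of the union *)

Section Packing.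
Variable R : realType.
Local Notation RR := (measurableTypeR R).
Local Notation V := (RR * (RR * RR))%type.
Variables (n : nat) (c : 'I_n -> V).
Hypothesis sep : forall i j, i != j -> 4 <= nsq (c i - c j).

Lemma measurable_coords : measurable_fun setT (fun p : V => p.1 : RR) /\
  (measurable_fun setT (fun p : V => p.2.1 : RR) /\ measurable_fun setT (fun p : V => p.2.2 : RR)).
Proof.
have m2 : measurable_fun setT (fun p : V => p.2) by exact: measurable_snd.
split; first exact: measurable_fst.
split.
  by apply: (measurableT_comp (f := fst : RR * RR -> RR)) m2; exact: measurable_fst.
by apply: (measurableT_comp (f := snd : RR * RR -> RR)) m2; exact: measurable_snd.
Qed.

Lemma measurable_dot (w : V) : measurable_fun setT (fun p : V => dot p w : RR).
Proof.
have [m1 [m2 m3]] := measurable_coords.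
by apply: measurable_funD; [|apply: measurable_funD]; apply: measurable_funM.
Qed.

Lemma measurable_nsq_sub (v : V) : measurable_fun setT (fun p : V => nsq (p - v) : RR).
Proof.
have [m1 [m2 m3]] := measurable_coords.
have b1 := measurable_funB m1 (measurable_cst v.1).
have b2 := measurable_funB m2 (measurable_cst v.2.1).
have b3 := measurable_funB m3 (measurable_cst v.2.2).
by apply: measurable_funD; [|apply: measurable_funD]; apply: measurable_funM.
Qed.

Lemma measurable_nsq : measurable_fun setT (fun p : V => nsq p : RR).
Proof. by have := measurable_nsq_sub 0; under eq_fun do rewrite subr0. Qed.

Lemma measurable_norm : measurable_fun setT (fun p : V => norm p : RR).
Proof.
apply: (measurableT_comp (f := Num.sqrt : RR -> RR)); last exact: measurable_nsq.
apply: continuous_measurable_fun; exact: sqrt_continuous.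
Qed.

Lemma measurable_pred (P : V -> bool) : measurable_fun setT P -> measurable [set p | P p].
Proof.
move=> mP; have -> : [set p | P p] = setT `&` P @^-1` [set true].
  by rewrite setTI; apply/seteqP; split.
exact: mP.
Qed.

Definition shell (r s : R) : set V := [set p | (r ^+ 2 <= nsq p) && (nsq p < s ^+ 2)].
Definition ball3 (v : V) (r : R) : set V := [set p | nsq (p - v) < r ^+ 2].

Lemma measurable_shell r s : measurable (shell r s).
Proof.
apply: measurable_pred; apply: measurable_and.
  by apply: measurable_fun_ler => //; exact: measurable_nsq.
by apply: measurable_fun_ltr => //; exact: measurable_nsq.
Qed.

Lemma measurable_ball3 v r : measurable (ball3 v r).
Proof.
by apply: measurable_pred; apply: measurable_fun_ltr => //; exact: measurable_nsq_sub.
Qed.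

Lemma measurable_exposed i : measurable [set y : V | exposed c i y].
Proof.
apply: measurable_pred; apply: measurable_and.
  by apply: measurable_fun_ltr => //; exact: measurable_nsq.
have -> : (fun y : V => [forall j, touch c i j ==> (dot y (c j - c i) <= norm y)]) =
    (fun y : V => all (fun j => touch c i j ==> (dot y (c j - c i) <= norm y)) (enum 'I_n)).
  apply/funext => y; apply/forallP/allP => h j; first by move=> _; exact: h.
  by apply: h; rewrite mem_enum.
elim: (enum 'I_n) => //= j s IH; apply: measurable_and => //.
case: (touch c i j) => //=; apply: measurable_fun_ler;
  [exact: measurable_dot | exact: measurable_norm].
Qed.
End Packing.

Lemma measure_bigsetU_le d (T : measurableType d) (R : realType) (m : {measure set T -> \bar R})
    (I : Type) (s : seq I) (F : I -> set T) : (forall i, measurable (F i)) ->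
  (m (\big[setU/set0]_(i <- s) F i) <= \sum_(i <- s) m (F i))%E.
Proof.
move=> mF; elim: s => [|i s IH]; rewrite ?big_nil ?measure0 // !big_cons.
apply: le_trans (leeD2l _ IH); apply: measureU2 => //; exact: bigsetU_measurable.
Qed.

(** * Symmetries of volume; balls and shells *)

Section Volumes.
Variable R : realType.
Local Notation RR := (measurableTypeR R).
Local Notation V := (RR * (RR * RR))%type.
Local Notation vol := (@volume R).
Local Notation lam := (@lebesgue_measure R).

Lemma volume_sgnv b (E : set V) : measurable E ->
  measurable [set p : V | E (sgnv b p)] /\ vol [set p : V | E (sgnv b p)] = vol E.
Proof.
move=> mE; have s0 (a : bool) : (-1) ^+ a != 0 :> R by rewrite signr_eq0.
have [mf e] := scales_diag 0 0 0 (s0 b.1.1) (s0 b.1.2) (s0 b.2).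
set f := (fun _ => _) in mf e.
have -> : [set p : V | E (sgnv b p)] = f @^-1` E.
  by apply/seteqP; split=> p; rewrite /f /sgnv /= !addr0.
split; first by rewrite -[X in measurable X]setTI; exact: mf.
by rewrite (e _ mE) !normr_sign !invr1 !mulr1 mul1e.
Qed.

Lemma volume_rot j (E : set V) : measurable E ->
  measurable [set p : V | E (iter j (@rot3 RR) p)] /\
  vol [set p : V | E (iter j (@rot3 RR) p)] = vol E.
Proof.
move=> mE; elim: j => [//|j [mj ej]].
have [mf e] := @scales_rot3 R.
have -> : [set p : V | E (iter j.+1 (@rot3 RR) p)] =
    (@rot3 RR) @^-1` [set p : V | E (iter j (@rot3 RR) p)].
  by apply/seteqP; split=> p; rewrite /= -iterSr.
split; first by rewrite -[X in measurable X]setTI; exact: mf.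
by rewrite (e _ mj) mul1e; exact: ej.
Qed.

Lemma volume_translate (v : V) (E : set V) : measurable E ->
  measurable [set p : V | E (p - v)] /\ vol [set p : V | E (p - v)] = vol E.
Proof.
move=> mE; have o0 := @oner_neq0 R.
have [mf e] := scales_diag (- v.1) (- v.2.1) (- v.2.2) o0 o0 o0.
set f := (fun _ => _) in mf e.
have -> : [set p : V | E (p - v)] = f @^-1` E.
  by apply/seteqP; split=> -[x [y z]]; rewrite /f /= !mul1r.
split; first by rewrite -[X in measurable X]setTI; exact: mf.
by rewrite (e _ mE) !normr1 !invr1 !mulr1 mul1e.
Qed.

Definition unit_ball3 : set V := ball3 0 1.

Lemma volume_ball3 (v : V) (r : R) : 0 < r ->
  vol (ball3 v r) = ((r ^+ 3)%:E * vol unit_ball3)%E.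
Proof.
move=> r0; have ri0 : r^-1 != 0 by rewrite invr_neq0 // gt_eqF.
have [mf e] := scales_diag (- v.1 / r) (- v.2.1 / r) (- v.2.2 / r) ri0 ri0 ri0.
set f := (fun _ => _) in mf e.
have -> : ball3 v r = f @^-1` unit_ball3.
  have key p : nsq (f p) = nsq (p - v) / r ^+ 2.
    by rewrite /f /nsq /dot /=; field; rewrite gt_eqF.
  by apply/seteqP; split=> p; rewrite /unit_ball3 /ball3 /preimage /mkset subr0 expr1n key
    ltr_pdivrMr ?exprn_gt0 // mul1r.
rewrite e; last exact: measurable_ball3.
by rewrite normfV (gtr0_norm r0) invrK; congr ((_ : R)%:E * _)%E; ring.
Qed.

Lemma coord_bound (p : V) (L : R) : 0 <= L -> nsq p <= L ^+ 2 -> cube3 L p.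
Proof.
move=> L0; rewrite /nsq /dot => h.
have sq (x : R) : x * x <= L ^+ 2 -> `|x| <= L.
  by move=> hx; rewrite -(ler_pXn2r (ltn0Sn 1)) ?nnegrE // real_normK ?num_real // expr2.
have := sqr_ge0 p.1; have := sqr_ge0 p.2.1; have := sqr_ge0 p.2.2; rewrite !expr2 => h1 h2 h3.
split; first by apply: sq; lra.
by split; [apply: sq; lra | rewrite /cube1 /= in_itv /= -ler_norml; apply: sq; lra].
Qed.

Lemma volume_fin (E : set V) L : measurable E -> E `<=` cube3 L -> vol E \is a fin_num.
Proof.
move=> mE EL; rewrite ge0_fin_numE ?measure_ge0 //; apply: le_lt_trans (cube3_finite L).
by apply: le_measure; rewrite ?inE //; exact: cube3_measurable.
Qed.

Lemma volume_ball3_fin v r : 0 < r -> vol (ball3 v r) \is a fin_num.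
Proof.
move=> r0; rewrite volume_ball3 // fin_numM //.
apply: (@volume_fin _ 1); first exact: measurable_ball3.
by move=> p; rewrite /unit_ball3 /ball3 /= subr0 => /ltW; exact: coord_bound.
Qed.

(** Left unevaluated, as it cancels in the final inequality. *)
Definition ball_volume : R := fine (vol unit_ball3).

Lemma volume_ball3E v r : 0 < r -> vol (ball3 v r) = (r ^+ 3 * ball_volume)%:E.
Proof.
move=> r0; rewrite volume_ball3 // [RHS]EFinM; congr (_ * _)%E.
by rewrite /ball_volume fineK // volume_ball3_fin.
Qed.

Lemma ball_volume_gt0 : 0 < ball_volume.
Proof.
rewrite -lte_fin /ball_volume fineK ?volume_ball3_fin //.
(* The cube of side 1 about the origin lies in the unit ball since 3/4 < 1. *)
have mb := cube3_measurable (2^-1 : R).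
have lb : (vol (cube3 2^-1) = 1)%E.
  have mI : measurable ([set` `[- 2^-1, 2^-1]] : set RR) by exact: measurable_itv.
  have lI : lebesgue_measure ([set` `[- 2^-1, 2^-1 : R]] : set RR) = 1%E.
    rewrite lebesgue_measure_itv /= lte_fin ifT; last by lra.
    by rewrite -EFinD; congr EFin; lra.
  have e2 : area (cube2 (2^-1 : R)) = 1%E.
    rewrite /cube2 boxE; apply: etrans (product_measure1E lam lam mI mI) _.
    exact: etrans (f_equal2 (fun x y => x * y)%E lI lI) (mule1 _).
  rewrite /cube3 boxE; apply: etrans (product_measure1E lam (@area R) mI (cube2_measurable _)) _.
  exact: etrans (f_equal2 (fun x y => x * y)%E lI e2) (mule1 _).
apply: (@lt_le_trans _ _ (vol (cube3 2^-1))); first by rewrite lb.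
apply: le_measure; rewrite ?inE //; first exact: measurable_ball3.
move=> p [h1 [h2]]; rewrite /cube1 /= in_itv /= -ler_norml => h3.
rewrite /unit_ball3 /ball3 /= subr0 /nsq /dot.
have sq (x : R) : `|x| <= 2^-1 -> x * x <= 4^-1 by rewrite ler_norml => /andP[*]; nra.
by have := sq _ h1; have := sq _ h2; have := sq _ h3; lra.
Qed.

Lemma volume_shell r s : 0 < r -> r <= s -> vol (shell r s) = ((s ^+ 3 - r ^+ 3) * ball_volume)%:E.
Proof.
move=> r0 rs; have s0 := lt_le_trans r0 rs.
have e : ball3 (0 : V) s = ball3 0 r `|` shell r s.
  apply/seteqP; split=> p; rewrite /ball3 /shell /= subr0.
    by move=> h; have [h'|h'] := ltP (nsq p) (r ^+ 2); [left|right; apply/andP].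
  case=> [h|/andP[]//]; apply: lt_le_trans h _.
  by rewrite ler_pXn2r // nnegrE ltW.
have eU : vol (ball3 (0%R : V) s) = (vol (ball3 (0%R : V) r) + vol (shell r s))%E.
  rewrite e; apply: measureU; [exact: measurable_ball3 | exact: measurable_shell |].
  by apply/seteqP; split=> // p [] /=; rewrite /ball3 /shell /= subr0 ltNge => /negP h /andP[].
have := eU; rewrite !volume_ball3E // => h.
have f : vol (shell r s) \is a fin_num.
  apply: (@volume_fin _ s); first exact: measurable_shell.
  by move=> p /andP[_ /ltW]; apply: coord_bound; exact: ltW.
move: (vol (shell r s)) f h => -[w| |] // _ [] h; congr EFin.
by rewrite mulrBl h; ring.
Qed.
End Volumes.

Lemma fine_le_sum (R : realDomainType) (I : finType) (x y : \bar R) (E : I -> \bar R) :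
  x \is a fin_num -> y \is a fin_num -> (forall i, E i \is a fin_num) ->
  (x <= y + \sum_i E i)%E -> fine x <= fine y + \sum_i fine (E i).
Proof.
move=> fx fy fE h; rewrite -lee_fin EFinD -sumEFin (fineK fx) (fineK fy).
by under eq_bigr do rewrite (fineK (fE _)).
Qed.

Section PackingVolume.
Variable R : realType.
Local Notation RR := (measurableTypeR R).
Local Notation V := (RR * (RR * RR))%type.
Local Notation vol := (@volume R).
Local Notation ball_volume := (ball_volume R).
Variables (n : nat) (c : 'I_n -> V).
Hypothesis sep : forall i j, i != j -> 4 <= nsq (c i - c j).

Definition exposed_shell i (s : R) : set V := shell 2 s `&` [set y | exposed c i y].

Lemma measurable_exposed_shell i s : measurable (exposed_shell i s).
Proof. apply: measurableI; [exact: measurable_shell | exact: measurable_exposed]. Qed.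

Lemma exposed_shell_fin i s : 0 < s -> vol (exposed_shell i s) \is a fin_num.
Proof.
move=> s0; apply: (@volume_fin _ _ s); first exact: measurable_exposed_shell.
by move=> p [/andP[_ /ltW h] _]; apply: coord_bound => //; exact: ltW.
Qed.

(** The 24 preimages of the exposed shell have equal volume and cover each point of the shell at
    most 4 (12 - [deg c i]) times, whence the ratio (12 - [deg c i]) / 6. *)
Lemma exposed_shell_volume i (s : R) : 2 <= s ->
  fine (vol (exposed_shell i s)) <= (12 - deg c i)%N%:R / 6 * ((s ^+ 3 - 8) * ball_volume).
Proof.
move=> s2; have s0 : 0 < s by lra.
pose F (k : (bool * bool * bool) * 'I_3) : set V :=
  [set p | exposed_shell i s (sgnv k.1 (iter k.2 (@rot3 RR) p))].
have mE := measurable_exposed_shell i s.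
have mF k : measurable (F k) /\ vol (F k) = vol (exposed_shell i s).
  have [m1 e1] := volume_sgnv k.1 mE; have [m2 e2] := volume_rot k.2 m1.
  split; first exact: m2.
  by rewrite -e1; exact: e2.
have nsqF (k : (bool * bool * bool) * 'I_3) (p : V) :
    nsq (sgnv k.1 (iter k.2 (@rot3 RR) p)) = nsq p.
  rewrite /nsq dot_sgnv; elim: (k.2 : nat) => //= j <-.
  by rewrite /dot /rot3 /=; ring.
have mult : (\sum_k vol (F k) <= (48 - 4 * deg c i)%N%:R%:E * vol (shell 2 s))%E.
  apply: multiplicity_le => [k||k p|p Sp].
  - exact: (mF k).1.
  - exact: measurable_shell.
  - by case; rewrite /shell /= nsqF.
  have := orbit24_count_exposed sep i p; have := deg_le sep i.
  have : (\sum_k `[< F k p >] <= orbit24_count (exposed c i) p)%N.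
    rewrite /orbit24_count pair_bigA /=; apply: leq_sum => k _.
    by case: asboolP => // -[_ /= ->].
  move: (\sum_k _)%N (orbit24_count _ _) (deg _ _) => u v w; lia.
move: mult; rewrite (eq_bigr (fun=> vol (exposed_shell i s))); last by move=> k _; exact: (mF k).2.
rewrite volume_shell //.
have := exposed_shell_fin i s0; move: (vol (exposed_shell i s)) => -[w| |] // _.
rewrite sumEFin -EFinM lee_fin sumr_const card_prod !card_prod card_bool card_ord -mulr_natr /=.
have := deg_le sep i; move: (deg c i) => dg hdg.
have -> : (48 - 4 * dg)%N = (4 * (12 - dg))%N by lia.
rewrite natrM; move: (12 - dg)%N%:R => m h.
have : w * 24 <= 4 * m * ((s ^+ 3 - 8) * ball_volume).
  by apply: le_trans (le_trans h _); rewrite le_eqVlt; apply/orP; left; apply/eqP; ring.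
by move: (_ * ball_volume) => t; lra.
Qed.

Definition unionB (r : R) : set V := \big[setU/set0]_(i < n) ball3 (c i) r.

Lemma unionBP r p : unionB r p <-> exists i, nsq (p - c i) < r ^+ 2.
Proof.
rewrite /unionB; split.
  by elim/big_ind: _ => [//|A B hA hB [/hA|/hB]|i _ h]; [ | |exists i].
by case=> i h; rewrite (bigD1 i) //=; left.
Qed.

Lemma measurable_unionB r : measurable (unionB r).
Proof. by apply: bigsetU_measurable => i _; exact: measurable_ball3. Qed.

(** Brunn-Minkowski wants one cube around all its sets, so [L] serves every radius up to [r];
    [r <= L] makes room for the small ball at the origin. *)
Lemma unionB_bounded r : 0 < r ->
  exists2 L, r <= L & forall s, s <= r -> 0 <= s -> unionB s `<=` cube3 L.
Proof.
move=> r0; pose M := \sum_i norm (c i).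
have M0 : 0 <= M by apply: sumr_ge0 => i _; exact: norm_ge0.
exists (r + (M + 1)); first lra.
move=> s sr s0 p /unionBP [i hi]; apply: coord_bound; first lra.
have ci : norm (c i) <= M.
  by rewrite /M (bigD1 i) //= lerDl; apply: sumr_ge0 => j _; exact: norm_ge0.
have h1 : nsq (p - c i) < r ^+ 2.
  by apply: lt_le_trans hi _; rewrite ler_pXn2r // ?nnegrE // ltW.
have h2 : nsq (c i) < (M + 1) ^+ 2.
  rewrite -norm_sqr ltr_pXn2r ?nnegrE ?norm_ge0 //; lra.
rewrite -(subrK (c i) p); apply/ltW/nsqD_lt => //; [exact: ltW | lra].
Qed.

Lemma unionB_fin r : 0 < r -> vol (unionB r) \is a fin_num.
Proof.
move=> r0; have [L _ h] := unionB_bounded r0.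
by apply: (@volume_fin _ _ L); [exact: measurable_unionB | apply: h => //; exact: ltW].
Qed.

Lemma unionB_ge : n%:R * ball_volume <= fine (vol (unionB 2)).
Proof.
rewrite -lee_fin fineK ?unionB_fin //.
have -> : ((n%:R * ball_volume)%:E = \sum_(i < n) vol (ball3 (c i) 1))%E.
  rewrite (eq_bigr (fun=> ball_volume%:E)); last first.
    by move=> i _; apply: etrans (volume_ball3E _ ltr01) _; rewrite expr1n mul1r.
  by rewrite sumEFin sumr_const card_ord mulr_natl.
have <- : vol (unionB 1) = (\sum_(i < n) vol (ball3 (c i) 1))%E.
  apply: measure_bigsetU_ord => [i|]; first exact: measurable_ball3.
  apply/trivIsetP => i j _ _ ij; apply/seteqP; split=> // p [/= h1 h2].
  have := sep ij; rewrite leNgt => /negP; apply.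
  (* A common point [p] of two open unit balls would bring their centers closer than 2. *)
  have -> : c i - c j = - (p - c i) + (p - c j) by rewrite opprB addrA subrK.
  rewrite (_ : 4 = (1 + 1) ^+ 2); last by ring.
  apply: nsqD_lt => //.
  by have -> : nsq (- (p - c i)) = nsq (p - c i) by rewrite /nsq /dot /=; ring.
apply: le_measure; rewrite ?inE; try exact: measurable_unionB.
move=> p /unionBP [i h]; apply/unionBP; exists i; apply: lt_le_trans h _.
by rewrite ler_pXn2r ?nnegrE //; lra.
Qed.

(** Assign [p] to a nearest center [c i]. Comparing its distance with that to a touching [c j] gives
    [dot (p - c i) (c j - c i)] <= 2, and outside [unionB 2] this is at most [norm (p - c i)], so
    [p - c i] is exposed. *)
Lemma unionB_cover s : 2 <= s ->
  unionB s `<=` unionB 2 `|` \big[setU/set0]_(i < n) [set p : V | exposed_shell i s (p - c i)].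
Proof.
move=> s2 p /unionBP [i0 h0].
have [i _ imin] := Order.TotalTheory.arg_minP (fun i => nsq (p - c i)) (isT : predT i0).
have [lt4|ge4] := ltP (nsq (p - c i)) (2 ^+ 2); first by left; apply/unionBP; exists i.
right; rewrite (bigD1 i) //=; left; split.
  by apply/andP; split=> //; apply: le_lt_trans h0; exact: imin.
apply/andP; split; first by apply: lt_le_trans ge4; rewrite exprn_gt0.
apply/forallP => j; apply/implyP => /eqP tij.
have t4 : nsq (c j - c i) = 4 := tij.
have := imin j isT; have -> : p - c j = (p - c i) - (c j - c i) by rewrite opprB addrA subrK.
have -> : nsq (p - c i - (c j - c i)) = nsq (p - c i) - 2 * dot (p - c i) (c j - c i)
  + nsq (c j - c i) := nsqB _ _.
rewrite t4 => h.
have : 2 <= norm (p - c i) by rewrite -(ler_pXn2r (ltn0Sn 1)) ?nnegrE ?norm_ge0 // norm_sqr.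
by move: h; move: (dot _ _) (nsq _) (norm _) => a b d; lra.
Qed.

Lemma unionB_growth s : 2 <= s ->
  fine (vol (unionB s)) <= fine (vol (unionB 2)) +
    (\sum_i (12 - deg c i))%N%:R / 6 * ((s ^+ 3 - 8) * ball_volume).
Proof.
move=> s2; have s0 : 0 < s by lra.
have mT i := volume_translate (c i) (measurable_exposed_shell i s).
have mU : measurable (\big[setU/set0]_(i < n) [set p : V | exposed_shell i s (p - c i)]).
  by apply: bigsetU_measurable => i _; exact: (mT i).1.
have h : (vol (unionB s) <= vol (unionB 2) + \sum_(i < n) vol (exposed_shell i s))%E.
  apply: (@le_trans _ _ (vol (unionB 2 `|`
    \big[setU/set0]_(i < n) [set p : V | exposed_shell i s (p - c i)]))).
    apply: le_measure; rewrite ?inE; [exact: measurable_unionB | | exact: unionB_cover].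
    by apply: measurableU => //; exact: measurable_unionB.
  apply: le_trans (measureU2 _ (measurable_unionB 2) mU) _; apply: leeD2l.
  apply: le_trans (measure_bigsetU_le _ _ (fun i => (mT i).1)) _.
  by apply: lee_sum => i _; rewrite -[leRHS](mT i).2.
have f2 := unionB_fin (ltr0Sn R 1); have fs := unionB_fin s0.
have h' := fine_le_sum fs f2 (fun i => exposed_shell_fin i s0) h.
apply: le_trans h' _; rewrite lerD2l.
apply: le_trans (ler_sum _ (fun i _ => exposed_shell_volume i s2)) _.
by rewrite -mulr_suml -mulr_suml natr_sum.
Qed.
End PackingVolume.

Lemma cube_root (R : realType) (x : R) : 0 < x -> exists2 a, 0 < a & a ^+ 3 = x.
Proof.
move=> x0; exists (x `^ 3^-1); first exact: powR_gt0.
by rewrite -powR_mulrn ?powR_ge0 // -powRrM mulVf // powRr1 // ltW.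
Qed.

(** [X] and [Y] stand for the volumes at radii 2 and 2 + [h], [B] for that of the unit ball, and [M]
    for the total deficiency. *)
Lemma growth_arith (R : realFieldType) (X Y B M nu m a b : R) : let h := 10^-1 in
  0 < nu -> nu ^+ 3 = m -> 0 < a -> 0 < b -> a ^+ 3 = X -> b ^+ 3 = B -> m * B <= X ->
  (a + h * b) ^+ 3 <= Y -> Y <= X + M / 6 * (((2 + h) ^+ 3 - 8) * B) ->
  18 * nu ^+ 2 <= 1261 / 100 * M.
Proof.
move=> h nu0 num a0 bp a3 b3 ge bm gr.
have h0 : 0 < h by rewrite /h; lra.
have ap := ltW a0; have bge := ltW bp; have hge := ltW h0.
have nb0 : 0 <= nu * b by rewrite mulr_ge0 // ltW.
have anb : nu * b <= a.
  by rewrite -(ler_pXn2r (ltn0Sn 2)) ?nnegrE // exprMn num b3 a3.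
have le1 : (a + h * b) ^+ 3 <= a ^+ 3 + M / 6 * (((2 + h) ^+ 3 - 8) * b ^+ 3).
  by apply: le_trans bm _; rewrite a3 b3; exact: gr.
(* Only the first-order term in [h] of (a + h b)^3 - a^3 is kept, with a >= nu b. *)
have le2 : 3 * h * (nu * b) ^+ 2 * b <= M / 6 * (((2 + h) ^+ 3 - 8) * b ^+ 3).
  have sq : (nu * b) ^+ 2 <= a ^+ 2 by rewrite ler_pXn2r ?nnegrE.
  have k1 : (nu * b) ^+ 2 * (3 * h * b) <= a ^+ 2 * (3 * h * b).
    by rewrite ler_pM2r // !mulr_gt0 //; lra.
  have k2 : 0 <= 3 * a * (h * b) ^+ 2 + (h * b) ^+ 3.
    by rewrite addr_ge0 ?mulr_ge0 ?exprn_ge0 ?mulr_ge0.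
  have e1 : (a + h * b) ^+ 3 =
    a ^+ 3 + a ^+ 2 * (3 * h * b) + (3 * a * (h * b) ^+ 2 + (h * b) ^+ 3).
    by ring.
  have e2 : 3 * h * (nu * b) ^+ 2 * b = (nu * b) ^+ 2 * (3 * h * b) by ring.
  move: le1; rewrite e1 e2; lra.
(* Dividing by this factor leaves 18 nu^2 on the left and ((2 + h)^3 - 8) / h = 1.261 / 0.1 = 12.61
   times [M] on the right. *)
have c0 : 0 < b ^+ 3 * (h / 6) by rewrite mulr_gt0 ?exprn_gt0 // divr_gt0.
rewrite -(ler_pM2r c0).
have -> : 18 * nu ^+ 2 * (b ^+ 3 * (h / 6)) = 3 * h * (nu * b) ^+ 2 * b by field.
apply: le_trans le2 _; rewrite le_eqVlt; apply/orP; left; apply/eqP.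
by rewrite /h; field.
Qed.

Section Deficiency.
Variable R : realType.
Local Notation RR := (measurableTypeR R).
Local Notation V := (RR * (RR * RR))%type.
Local Notation vol := (@volume R).
Variables (n : nat) (c : 'I_n -> V).
Hypothesis sep : forall i j, i != j -> 4 <= nsq (c i - c j).

Lemma deficiency_ge (nu : R) : 0 < nu -> nu ^+ 3 = n%:R ->
  18 * nu ^+ 2 <= 1261 / 100 * (\sum_i (12 - deg c i))%N%:R.
Proof.
move=> nu0 nun; set M := (\sum_i _)%N%:R.
pose h : R := 10^-1; have h0 : 0 < h by rewrite /h; lra.
have s0 : 0 < 2 + h by lra.
have s2 : 2 <= 2 + h by lra.
have b0 := ball_volume_gt0 R.
have n0 : 0 < n%:R :> R by rewrite -nun exprn_gt0.
have A0 : 0 < fine (vol (unionB c 2)) by apply: lt_le_trans (unionB_ge sep); exact: mulr_gt0.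
have [a a0 a3] := cube_root A0; have [b bp b3] := cube_root b0.
have [L L0 bnd] := unionB_bounded c s0.
have bm : (a + h * b) ^+ 3 <= fine (vol (unionB c (2 + h))).
  have mA := measurable_unionB c 2; have mC := measurable_unionB c (2 + h).
  have mB := measurable_ball3 (0 : V) h.
  have AL : unionB c 2 `<=` cube3 L by apply: bnd; lra.
  have CL : unionB c (2 + h) `<=` cube3 L by apply: bnd; lra.
  have BL : ball3 (0 : V) h `<=` cube3 L.
    move=> p; rewrite /ball3 /= subr0 => /ltW hp; apply: coord_bound; first lra.
    by apply: le_trans hp _; rewrite ler_pXn2r ?nnegrE //; lra.
  apply: (volume_brunn_minkowski mA mB mC AL BL CL a0 (mulr_gt0 h0 bp)).
  - by rewrite a3; apply: esym; apply: fineK; apply: unionB_fin; lra.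
  - by apply: etrans (volume_ball3E _ h0) _; rewrite exprMn b3.
  move=> p q /unionBP [i hi]; rewrite /ball3 /= subr0 => hq; apply/unionBP; exists i.
  have -> : p + q - c i = (p - c i) + q by rewrite addrAC.
  by apply: nsqD_lt => //; lra.
exact: (growth_arith nu0 nun a0 bp a3 b3 (unionB_ge sep) bm (unionB_growth sep s2)).
Qed.
End Deficiency.

(** * Double counting over lists of pairs *)

Lemma length_filter_sum (T : Type) (P : T -> bool) (l : list T) :
  length (List.filter P l) = (\sum_(x <- l) P x)%N.
Proof. by elim: l => [|x l IH]; rewrite ?big_nil ?big_cons //= -IH; case: (P x). Qed.

Lemma sum_list_prod (S T : Type) (f : S -> T -> nat) (l : list S) (m : list T) :
  (\sum_(p <- list_prod l m) f p.1 p.2 = \sum_(x <- l) \sum_(y <- m) f x y)%N.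
Proof.
elim: l => [|x l IH]; rewrite ?big_nil ?big_cons //=.
by rewrite -[List.app _ _]/(_ ++ _) big_cat /= IH big_map.
Qed.

Lemma list_seq_iota k m : List.seq k m = iota k m.
Proof. by elim: m k => //= m IH k; rewrite IH. Qed.

Lemma symmetric_sum_double n (f : nat -> nat -> bool) : (forall i j, f i j = f j i) ->
  (forall i, (i < n)%N -> f i i = false) ->
  (\sum_(i < n) \sum_(j < n) f i j = (\sum_(i < n) \sum_(j < n) ((i < j) && f i j)).*2)%N.
Proof.
move=> fC f0; rewrite -addnn [X in (_ + X)%N]exchange_big -big_split /=.
apply: eq_bigr => i _; rewrite -big_split /=; apply: eq_bigr => j _.
by rewrite (fC j i); case: ltngtP => [||e] /=; rewrite ?addn0 ?add0n //; rewrite -e f0.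
Qed.

(** * Contact graphs *)

Section Contacts.
Variables (n : nat) (c : nat -> point3).

Definition center (i : nat) : R * (R * R) := ((c i).1.1, ((c i).1.2, (c i).2)).

Lemma dist3_nsq i j : dist3 (c i) (c j) = Num.sqrt (nsq (center i - center j)).
Proof.
rewrite /dist3 /center; case: (c i) => -[x y] z; case: (c j) => -[x' y'] z' /=.
rewrite RsqrtE; congr Num.sqrt.
by rewrite !(RplusE, RminusE, RmultE, R1E) /nsq /dot /=; ring.
Qed.

Lemma R2E : IZR 2 = 2%:R :> R.
Proof. by rewrite IZRposE INRE. Qed.

Lemma sqrt_four : Num.sqrt (4%R : R) = 2%R.
Proof. by rewrite (_ : 4 = 2 ^+ 2) ?sqrtr_sqr ?ger0_norm //; ring. Qed.

Lemma touchb_nsq i j : touchb (c i) (c j) = (nsq (center j - center i) == 4).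
Proof.
have -> : nsq (center j - center i) = nsq (center i - center j).
  by rewrite /nsq /dot /=; ring.
rewrite /touchb; case: (Req_dec_T (dist3 (c i) (c j)) (IZR 2)) => h; symmetry.
  by apply/eqP; rewrite -norm_sqr /norm -dist3_nsq h R2E; ring.
by apply/negbTE/negP => /eqP e; apply: h; rewrite dist3_nsq e sqrt_four R2E.
Qed.

Hypothesis hpack : is_unit_ball_packing n c.

Lemma center_sep (i j : 'I_n) : i != j -> 4 <= nsq (center i - center j).
Proof.
move=> ij; have /RlebP : (IZR 2 <= dist3 (c i) (c j))%coqR.
  by apply: hpack; [exact/ssrnat.ltP|exact/ssrnat.ltP|move=> e; move: ij; rewrite (val_inj e) eqxx].
rewrite dist3_nsq R2E => h.
rewrite -norm_sqr /norm (_ : 4 = 2 ^+ 2); last by ring.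
by rewrite ler_pXn2r ?nnegrE ?sqrtr_ge0.
Qed.

(** Handshake count: [contact_number] takes each contact once, as a pair with i < j, the degrees
    from both ends. *)
Lemma contact_number_deg :
  ((contact_number n c).*2 = \sum_(i < n) deg (fun j : 'I_n => center j) i)%N.
Proof.
pose f i j := touchb (c i) (c j).
have fC i j : f i j = f j i.
  by rewrite /f !touchb_nsq; congr (_ == _); rewrite /nsq /dot /=; ring.
have f0 i : (i < n)%N -> f i i = false.
  by move=> _; rewrite /f touchb_nsq subrr /nsq /dot /= !mul0r !addr0 eq_sym pnatr_eq0.
have -> : contact_number n c = (\sum_(i < n) \sum_(j < n) ((i < j) && f i j))%N.
  rewrite /contact_number length_filter_sum !list_seq_iota.
  rewrite (sum_list_prod (fun i j => Nat.ltb i j && f i j)) -/(iota 0 n).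
  have -> : iota 0 n = index_iota 0 n by rewrite /index_iota subn0.
  rewrite big_mkord; apply: eq_bigr => i _; rewrite big_mkord; apply: eq_bigr => j _.
  congr (_ && _ : nat).
  by apply/idP/idP => [/Nat.ltb_lt/ssrnat.ltP|/ssrnat.ltP/Nat.ltb_lt].
rewrite -(symmetric_sum_double fC f0); apply: eq_bigr => i _.
rewrite /deg -sum1_card [RHS]big_mkcond /=; apply: eq_bigr => j _.
by rewrite /f touchb_nsq unfold_in /= /touch; case: eqP.
Qed.

(** Half of the deficiency is at least (900 / 1261) nu^2, and 900 / 1261 > 0.695; positivity of [nu]
    makes the bound strict. *)
Lemma contact_number_bound (nu : R) : (0 < n)%N -> 0 < nu -> nu ^+ 3 = n%:R ->
  (contact_number n c)%:R < 6 * n%:R - 695 / 1000 * nu ^+ 2.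
Proof.
move=> n0 nu0 nun.
have := deficiency_ge (c := fun j : 'I_n => center j) center_sep nu0 nun.
set D := (\sum_i _)%N => h.
(* The truncated subtractions in [D] are exact because degrees are at most 12. *)
have e : (D + (contact_number n c).*2 = 12 * n)%N.
  rewrite contact_number_deg /D -big_split /= (eq_bigr (fun=> 12%N)).
    by rewrite sum_nat_const card_ord mulnC.
  by move=> i _; rewrite subnK //; apply: deg_le; exact: center_sep.
have : ((D%:R + 2%:R * (contact_number n c)%:R)%R = (12%:R * n%:R)%R :> R).
  by rewrite -!natrM -natrD mul2n e.
have : 0 < nu ^+ 2 by rewrite exprn_gt0.
move: h; move: (nu ^+ 2) (D%:R : R) ((contact_number n c)%:R : R) (n%:R : R) => x y z w *.
lra.
Qed.
End Contacts.

Lemma contact_number_lt (n : nat) (hn : (2 <= n)%coq_nat) (c : nat -> point3)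
  (hpack : is_unit_ball_packing n c) :
  (INR (contact_number n c) < 6 * INR n - (695 / 1000) * Rpower (INR n) (2 / 3))%coqR.
Proof.
have n0 : (0 < n)%N by move/ssrnat.leP: hn => /(leq_trans _); apply.
have nR : (0 < INR n)%coqR by apply: lt_0_INR; apply/ssrnat.ltP.
(* The cube root of n, whose square is n^(2/3). *)
set nu := Rpower (INR n) (/ 3).
have nu0 : (0 < nu)%coqR by apply: exp_pos.
have nu3 : (nu ^ 3)%coqR = INR n.
  rewrite -Rpower_pow // Rpower_mult (_ : (/ 3 * INR 3)%coqR = 1%coqR) ?Rpower_1 //.
  by rewrite INR_IZR_INZ Rinv_l //; apply: not_0_IZR.
have nu2 : (nu ^ 2)%coqR = Rpower (INR n) (2 / 3).
  by rewrite -Rpower_pow // Rpower_mult INR_IZR_INZ Rmult_comm.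
have := contact_number_bound hpack n0 (introT (RltbP _ _) nu0).
rewrite -!RpowE nu3 nu2 -!INRE => /(_ erefl) /RltbP.
rewrite -RdivE -!RmultE -RminusE; congr (_ < _ * _ - _ / _ * _)%coqR; rewrite IZRposE INRE //.
Qed.

End ContactBound.

Theorem theorem1 (n : nat) (hn : (2 <= n)%nat) (c : nat -> point3)
  (hpack : is_unit_ball_packing n c) :
  INR (contact_number n c) < 6 * INR n - (695 / 1000) * Rpower (INR n) (2 / 3).
Proof. exact (ContactBound.contact_number_lt hn hpack). Qed.
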